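(* Let $m,n\geq 1$ and let $\tilde x_i(s,u;t,v)\in\mathbb{C}[s,u,t,v]$, $1\le i\le4$, be bihomogeneous polynomials of bi-degree $(m,n)$. Suppose that the parametrization $\left(\frac{\tilde x_1}{\tilde x_4},\frac{\tilde x_2}{\tilde x_4},\frac{\tilde x_3}{\tilde x_4}\right)$ defines a surface which has no base points, and that there are no (nonzero) moving planes of bi-degree $(m-1,n-1)$ following the surface. Then the method of moving quadrics applies and computes a power of the implicit equation of this surface: if $F\in\mathbb{C}[X_1,X_2,X_3,X_4]$ denotes the irreducible homogeneous polynomial defining the surface, the determinant produced by the method equals $\lambda F^{k}$ for some $\lambda\in\mathbb{C}\setminus\{0\}$ and some integer $k\ge1$.
   Context: No base points means that there is no point of $\mathbb{P}^1_{\mathbb{C}}\times\mathbb{P}^1_{\mathbb{C}}$ at which $\tilde x_1,\tilde x_2,\tilde x_3,\tilde x_4$ all vanish. The implicit equation $F=0$ is the equation of the smallest algebraic surface in $\mathbb{P}^3_{\mathbb{C}}$ containing the image of the parametrization $(\tilde x_1:\tilde x_2:\tilde x_3:\tilde x_4)$. The parametrization is not assumed to be generically one-to-one. A moving $d$-surface of bi-degree $(\sigma_1,\sigma_2)$ is an expression $\sum_{i=0}^{\sigma_1}\sum_{j=0}^{\sigma_2}\bigl(\sum_{|\gamma|=d}A^{ij}_\gamma X^\gamma\bigr)s^iu^{\sigma_1-i}t^jv^{\sigma_2-j}$ with $A^{ij}_\gamma\in\mathbb{C}$, $\gamma\in\mathbb{Z}_{\ge 0}^4$, $X^\gamma=X_1^{\gamma_1}\cdots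 X_4^{\gamma_4}$. It follows the rational surface if it becomes identically zero as a polynomial in $s,u,t,v$ after substituting $X_a=\tilde x_a(s,u;t,v)$, $a=1,\dots,4$. For $d=1$ it is called a moving plane, for $d=2$ a moving quadric. Method of moving quadrics (tensor product case): take a basis of $mn$ moving quadrics for the $\mathbb{C}$-vector space of moving quadrics of bi-degree $(m-1,n-1)$ that follow the surface; write each as $\sum_{0\le i\le m-1,\,0\le j\le n-1}Q_{ij}(X)\,s^iu^{m-1-i}t^jv^{n-1-j}$ with $Q_{ij}$ a quadratic form in $X_1,\dots,X_4$; form the $mn\times mn$ matrix whose columns correspond to the basis elements and whose rows are indexed by $(i,j)$, with entries $Q_{ij}$. The output of the method is the determinant of this matrix. *)

(* Defs.v *)
From HB Require Import structures.
From mathcomp Require Import all_boot all_order all_algebra.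
From mathcomp Require Import complex.
From mathcomp Require Import reals.
From mathcomp Require Import mpoly.

Set Implicit Arguments.
Unset Strict Implicit.
Unset Printing Implicit Defensive.

Import GRing.Theory.
Local Open Scope ring_scope.

(* The parameters s, u, t, v are the variables 0, 1, 2, 3 of {mpoly C[4]};
   X_1, ..., X_4 are the variables 0, ..., 3 of another copy of {mpoly C[4]}. *)
Definition i_s : 'I_4 := @Ordinal 4 0 isT.
Definition i_u : 'I_4 := @Ordinal 4 1 isT.
Definition i_t : 'I_4 := @Ordinal 4 2 isT.
Definition i_v : 'I_4 := @Ordinal 4 3 isT.

Definition bihomogeneous (C : fieldType) (m n : nat) (p : {mpoly C[4]}) : Prop :=
  forall mo : 'X_{1..4}, mo \in msupp p ->
    (mo i_s + mo i_u = m)%N /\ (mo i_t + mo i_v = n)%N.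

(* Coordinates ((s : u), (t : v)) of a point of P^1 x P^1. *)
Definition biprojective (C : fieldType) (p : 'I_4 -> C) : Prop :=
  ((p i_s != 0) || (p i_u != 0)) && ((p i_t != 0) || (p i_v != 0)).

Definition projective (C : fieldType) (y : 'I_4 -> C) : Prop :=
  exists a : 'I_4, y a != 0.

Definition param_eval (C : fieldType) (x : 4.-tuple {mpoly C[4]})
    (p : 'I_4 -> C) : 'I_4 -> C :=
  fun a => (tnth x a).@[p].

Definition no_base_points (C : fieldType) (x : 4.-tuple {mpoly C[4]}) : Prop :=
  forall p : 'I_4 -> C, biprojective p -> projective (param_eval x p).

(* The coordinate functions x_a / x_4 as elements of C(s,u,t,v). *)
Definition affine_coord (C : fieldType) (x : 4.-tuple {mpoly C[4]}) (a : 'I_4) :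
    {fraction {mpoly C[4]}} :=
  tofrac (tnth x a) / tofrac (tnth x ord_max).

Definition algebraically_independent (C : fieldType) (k : nat)
    (f : 'I_k -> {fraction {mpoly C[4]}}) : Prop :=
  forall P : {mpoly C[k]}, mmap (fun c : C => tofrac (c%:MP)) f P = 0 -> P = 0.

(* The rational map (x_1/x_4, x_2/x_4, x_3/x_4) is defined and its image has
   dimension 2, i.e. its coordinates generate a field of transcendence degree 2
   (which is also the maximum possible when the x_a are bihomogeneous of the
   same bi-degree).  No assumption is made on the degree of the map. *)
Definition defines_surface (C : fieldType) (x : 4.-tuple {mpoly C[4]}) : Prop :=
  tnth x ord_max != 0 /\
  exists g : 'I_2 -> 'I_4, algebraically_independent (fun a => affine_coord x (g a)).

Definition surface_polynomial (C : fieldType) (G : {mpoly C[4]}) : Prop :=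
  G != 0 /\ exists2 d : nat, (0 < d)%N & G \is d.-homog.

Definition vanishes_on_image (C : fieldType) (x : 4.-tuple {mpoly C[4]})
    (G : {mpoly C[4]}) : Prop :=
  forall p : 'I_4 -> C, biprojective p -> projective (param_eval x p) ->
    G.@[param_eval x p] = 0.

Definition mirreducible (C : fieldType) (F : {mpoly C[4]}) : Prop :=
  [/\ F != 0, F \isn't a GRing.unit &
      forall p q : {mpoly C[4]}, F = p * q ->
        p \is a GRing.unit \/ q \is a GRing.unit].

(* F is irreducible and homogeneous, and F = 0 is the smallest algebraic
   surface of P^3 containing the image of the parametrization. *)
Definition implicit_equation (C : fieldType) (x : 4.-tuple {mpoly C[4]})
    (F : {mpoly C[4]}) : Prop :=
  [/\ surface_polynomial F, mirreducible F, vanishes_on_image x F &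
      forall G : {mpoly C[4]}, surface_polynomial G -> vanishes_on_image x G ->
        forall y : 'I_4 -> C, projective y -> F.@[y] = 0 -> G.@[y] = 0].

(* A moving d-surface of bi-degree (s1, s2), given by its coefficients: the
   value at (i, j) is the degree d form in X_1, ..., X_4 multiplying
   s^i u^(s1-i) t^j v^(s2-j).  This is a finite dimensional C-vector space. *)
Definition moving_surface (C : fieldType) (d s1 s2 : nat) :=
  {ffun 'I_s1.+1 * 'I_s2.+1 -> dhomog 4 C d}.

Definition moving_plane (C : fieldType) := moving_surface C 1.
Definition moving_quadric (C : fieldType) := moving_surface C 2.

Definition follows (C : fieldType) (d s1 s2 : nat) (x : 4.-tuple {mpoly C[4]})
    (A : moving_surface C d s1 s2) : Prop :=
  \sum_(i < s1.+1) \sum_(j < s2.+1)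
    (mpoly_of_dhomog (A (i, j)) \mPo x) *
    ('X_i_s ^+ i * 'X_i_u ^+ (s1 - i) * 'X_i_t ^+ j * 'X_i_v ^+ (s2 - j)) = 0.

Definition following_quadrics_basis (C : fieldType) (m n : nat)
    (x : 4.-tuple {mpoly C[4]})
    (b : (m * n).-tuple (moving_quadric C m.-1 n.-1)) : Prop :=
  free b /\
  forall A : moving_quadric C m.-1 n.-1, (A \in <<b>>%VS) <-> follows x A.

(* Columns correspond to the elements of b; the row r stands for the pair
   (r %/ n, r %% n), which for m, n > 0 enumerates the (i, j) with i < m and
   j < n in lexicographic order (inord is then the identity on values). *)
Definition moving_quadrics_matrix (C : fieldType) (m n : nat)
    (b : (m * n).-tuple (moving_quadric C m.-1 n.-1)) :
    'M[{mpoly C[4]}]_(m * n) :=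
  \matrix_(r, c) mpoly_of_dhomog (tnth b c (inord (r %/ n), inord (r %% n))).

(* Main.v *)
(* Let R_(a,b) be the forms of bi-degree (a,b) in (s,u;t,v).  Having no moving
   planes makes the map (v_1, ..., v_4) |-> sum x_a v_a from R_(m-1,n-1)^4 to
   R_(2m-1,2n-1) bijective, both sides having dimension 4mn; hence the products
   x_a x_b v span R_(3m-1,3n-1), and the moving quadrics have dimension
   10mn - 9mn = mn.

   The determinant vanishes at y exactly when y lies on the image.  At a point
   of the image, the monomials s^i u^(m-1-i) t^j v^(n-1-j) give a left kernel
   vector.  Off the image, the three forms l_i(x), where the linear forms l_i
   cut out y, have no common zero on P^1 x P^1, and then they generate
   R_(3m-1,3n-1) over R_(2m-1,2n-1).  So the 9mn-dimensional space of quadrics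
   vanishing at y maps onto R_(3m-1,3n-1), hence injectively, and no nonzero
   moving quadric vanishes at y.

   The generation statement follows from the absence of syzygies of bi-degree
   (2m-1,n-1) among three such forms, since this makes R_(2m-1,n-1)^3 ->
   R_(3m-1,2n-1) an injective map between spaces of dimension 6mn.  For each
   value of s the syzygies of t-degree n-1 are freely spanned by the n
   Bezoutian ones, whose degree in s is 2m.

   Finally F is irreducible with the same zeros as the determinant, so the
   Nullstellensatz for hypersurfaces and unique factorization conclude. *)

Require Import Defs.
From HB Require Import structures.
From mathcomp Require Import all_boot all_order all_algebra.
From mathcomp Require Import complex.
From mathcomp Require Import reals.
From mathcomp Require Import mpoly.
From mathcomp Require Import perm.
From mathcomp Require Import ring zify.

Import GRing.Theory.
Local Open Scope ring_scope.

Set Implicit Arguments.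
Unset Strict Implicit.
Unset Printing Implicit Defensive.

(** * Factorization in polynomial rings *)

Section Factorization.
Variable A : idomainType.
Implicit Types a b c p q : A.

Definition rdivides a b := exists q, b = q * a.

Definition rirreducible a :=
  [/\ a != 0, a \isn't a GRing.unit &
      forall p q, a = p * q -> p \is a GRing.unit \/ q \is a GRing.unit].

Definition rprime a :=
  [/\ a != 0, a \isn't a GRing.unit &
      forall p q, rdivides a (p * q) -> rdivides a p \/ rdivides a q].

Definition atomic := forall a, a != 0 ->
  exists2 s : seq A, {in s, forall p, rirreducible p} &
    exists2 u, u \is a GRing.unit & a = u * \prod_(p <- s) p.

Lemma rdivides_mull a b c : rdivides a b -> rdivides a (c * b).
Proof. by case=> q ->; exists (c * q); rewrite mulrA. Qed.

End Factorization.

Lemma rdivides_polyC (A : idomainType) (p : A) (g : {poly A}) :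
  (forall i, rdivides p g`_i) -> rdivides p%:P g.
Proof.
elim/poly_ind: g => [|g c IH] H; first by exists 0; rewrite mul0r.
have [|q ->] := IH.
  by move=> i; have := H i.+1; rewrite coefD coefMX coefC /= addr0.
have := H 0%N; rewrite coefD coefMX coefC /= add0r => -[d ->].
by exists (q * 'X + d%:P); rewrite polyCM; ring.
Qed.

(** If [p] divides neither factor, let i and j be the first indices of a coefficient of [f], resp.
    [g], that it does not divide. Modulo [p], the coefficient of index i + j of the product is the
    product of these two, against primality in [A]. *)
Lemma rprime_polyC (A : idomainType) (p : A) : rprime p -> rprime p%:P.
Proof.
case=> p0 pU pP; split; first by rewrite polyC_eq0.
  by rewrite poly_unitE size_polyC p0 /= coefC eqxx.
move=> f g [h fgE].
have aux (f1 : {poly A}) : rdivides p%:P f1 \/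
    exists2 i, ~ rdivides p f1`_i & forall j, (j < i)%N -> rdivides p f1`_j.
  elim/poly_ind: f1 => [|f1 c IH]; first by left; exists 0; rewrite mul0r.
  case: (boolp.EM (rdivides p c)) => [pc|npc]; last first.
    by right; exists 0%N => //; rewrite coefD coefMX coefC /= add0r.
  case: IH => [[q ->]|[i ni Hi]].
    by case: pc => d ->; left; exists (q * 'X + d%:P); rewrite polyCM; ring.
  right; exists i.+1; first by rewrite coefD coefMX coefC /= addr0.
  by case=> [|j] lj; rewrite coefD coefMX coefC /= ?add0r // addr0; apply: Hi.
case: (aux f) => [|[i nfi Hi]]; first by left.
case: (aux g) => [|[j ngj Hj]]; first by right.
exfalso.
have : rdivides p (f`_i * g`_j).
  have := congr1 (fun r : {poly A} => r`_(i + j)) fgE.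
  rewrite coefMC coefM => E.
  have li : (i < (i + j).+1)%N by rewrite ltnS leq_addr.
  move: E; rewrite (bigD1 (Ordinal li)) //= addKn => E.
  have [q qE] : rdivides p (\sum_(k < (i + j).+1 | k != Ordinal li)
                  f`_k * g`_(i + j - k)).
    elim/big_rec: _ => [|k x ki [q ->]]; first by exists 0; rewrite mul0r.
    have [r rE] : rdivides p (f`_k * g`_(i + j - k)).
      have [lki|lik|eki] := ltngtP k i.
      - by rewrite mulrC; apply: rdivides_mull; apply: Hi.
      - apply: rdivides_mull; apply: Hj; move: (ltn_ord k) => lk.
        by rewrite ltn_subLR ?ltn_add2r // -ltnS.
      - by case/eqP: ki; apply: val_inj.
    by exists (r + q); rewrite rE mulrDl.
  exists (h`_(i + j) - q); rewrite mulrBl -E qE; ring.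
by case/pP.
Qed.

(** * Gauss's lemma over a factorial domain *)

Section Gauss.
Variable A : idomainType.
Hypothesis A_prime : forall a : A, rirreducible a -> rprime a.
Hypothesis A_atomic : atomic A.

(** Each irreducible factor of [c] is prime as a constant polynomial, so it divides [g] or [h] and
    cancels there without changing the degree. A factorization over the fraction field thus descends
    to [A]. *)
Lemma strip_constant (c : A) (f g h : {poly A}) : c != 0 ->
  c *: f = g * h -> exists g' h' : {poly A},
    [/\ f = g' * h', size g' = size g & size h' = size h].
Proof.
move=> /A_atomic [s sP [u uU ->]].
elim: s sP g h => [|p s IH] sP g h.
  rewrite big_nil mulr1 => E; exists (u^-1 *: g), h; split=> //.
    by rewrite -scalerAl -E scalerA mulVr // scale1r.
  by rewrite size_scale // invr_neq0 //; apply: contraTneq uU => ->; rewrite unitr0.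
rewrite big_cons => E.
have pI : rirreducible p by apply: sP; rewrite mem_head.
have sP' : {in s, forall q, rirreducible q}.
  by move=> q qs; apply: sP; rewrite inE qs orbT.
have p0 : p != 0 by case: pI.
have pc0 : p%:P != 0 by rewrite polyC_eq0.
have [_ _ pP] := rprime_polyC (A_prime pI).
have E1 : g * h = ((u * \prod_(q <- s) q) *: f) * p%:P.
  by rewrite -E -!mul_polyC !polyCM; ring.
have [|[q qE]|[q qE]] := pP g h; first by exists ((u * \prod_(q <- s) q) *: f).
  have [] := IH sP' q h.
    by apply: (mulIf pc0); rewrite -E1 qE; ring.
  move=> g' [h' [-> s1 s2]]; exists g', h'; split=> //.
  by rewrite s1 qE mulrC mul_polyC size_scale.
have [] := IH sP' g q.
  by apply: (mulIf pc0); rewrite -E1 qE; ring.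
move=> g' [h' [-> s1 s2]]; exists g', h'; split=> //.
by rewrite s2 qE mulrC mul_polyC size_scale.
Qed.

(** [dvdp] is divisibility up to a nonzero constant. The irreducible factors of that constant are
    prime and cannot divide [f], so they all divide the quotient and cancel. *)
Lemma irreducible_dvdp (f g : {poly A}) : rirreducible f -> (1 < size f)%N ->
  dvdp f g -> rdivides f g.
Proof.
move=> [f0 fU fI] sf; rewrite Pdiv.Idomain.dvdp_eq => /eqP.
set c := _ ^+ _; set q0 := divp _ _.
have : c != 0 by rewrite expf_neq0 // lead_coef_eq0.
move: q0; move: c => c0 q.
move=> /A_atomic [s sP [u uU ->]].
elim: s sP q => [|p s IH] sP q.
  rewrite big_nil mulr1 => E; exists (u^-1 *: q).
  by rewrite -scalerAl -E scalerA mulVr // scale1r.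
rewrite big_cons => E.
have pI : rirreducible p by apply: sP; rewrite mem_head.
have sP' : {in s, forall q, rirreducible q}.
  by move=> r rs; apply: sP; rewrite inE rs orbT.
have p0 : p != 0 by case: pI.
have pc0 : p%:P != 0 by rewrite polyC_eq0.
have [_ pcU pP] := rprime_polyC (A_prime pI).
have E1 : q * f = ((u * \prod_(q <- s) q) *: g) * p%:P.
  by rewrite -E -!mul_polyC !polyCM; ring.
have [|[r rE]|[r rE]] := pP q f; first by exists ((u * \prod_(q <- s) q) *: g).
  by apply: (IH sP' r); apply: (mulIf pc0); rewrite -E1 rE; ring.
have [] := fI _ _ rE; last by rewrite (negbTE pcU).
rewrite poly_unitE => /andP[/eqP sr _]; move: sf.
by rewrite rE mulrC mul_polyC size_scale // sr.
Qed.

(** The gcd is that of the fraction field. [strip_constant] turns it into a true factor of [f] of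
    the same degree, which irreducibility forces to be 0 or the degree of [f]. *)
Lemma irreducible_coprimep (f g : {poly A}) : rirreducible f ->
  (1 < size f)%N -> coprimep f g \/ rdivides f g.
Proof.
move=> fI sf; have [f0 fU fP] := fI.
set d := gcdp f g.
have df : dvdp d f by rewrite Pdiv.Idomain.dvdp_gcdl.
have dg : dvdp d g by rewrite Pdiv.Idomain.dvdp_gcdr.
have := df; rewrite Pdiv.Idomain.dvdp_eq => /eqP.
set c := _ ^+ _; set q0 := divp _ _ => E.
have d0 : d != 0 by rewrite Pdiv.Idomain.gcdp_eq0 (negbTE f0).
have c0 : c != 0 by rewrite expf_neq0 // lead_coef_eq0.
have [q [h [fE sq sh]]] := strip_constant c0 E.
have [] := fP _ _ fE.
  rewrite poly_unitE => /andP[/eqP s1 _]; right.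
  apply: irreducible_dvdp => //; apply: Pdiv.Idomain.dvdp_trans dg.
  have : size d == size f.
    rewrite -(size_scale f c0) E size_mul //; last first.
      by rewrite -size_poly_eq0 -sq s1.
    by rewrite -sq s1 add1n.
  by rewrite Pdiv.Idomain.dvdp_size_eqp // => /andP[].
rewrite poly_unitE => /andP[/eqP s1 _]; left.
by rewrite /coprimep -/d -sh s1.
Qed.

Lemma polyC_unitE (a : A) : (a%:P \is a GRing.unit) = (a \is a GRing.unit).
Proof.
rewrite poly_unitE size_polyC coefC /= eqb1.
by have [->|] := eqVneq a 0; rewrite ?unitr0.
Qed.

Lemma rirreducible_polyC (a : A) : rirreducible a%:P -> rirreducible a.
Proof.
case=> a0 aU aP; split; first by rewrite polyC_eq0 in a0.
  by apply: contraNN aU; rewrite polyC_unitE.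
  by move=> p q aE; rewrite -!polyC_unitE; apply: aP; rewrite aE polyCM.
Qed.

Lemma poly_irreducible_prime (f : {poly A}) : rirreducible f -> rprime f.
Proof.
move=> fI; have [f0 fU _] := fI.
case: (leqP (size f) 1) => [|sf].
  move=> /size1_polyC fE; rewrite fE in fI *.
  by apply/rprime_polyC/A_prime/rirreducible_polyC.
split=> // p q [r E].
have [cop|] := irreducible_coprimep p fI sf; last by left.
right; apply: irreducible_dvdp => //.
by rewrite -(Pdiv.Idomain.Gauss_dvdpr q cop) E Pdiv.Idomain.dvdp_mull ?Pdiv.Idomain.dvdpp.
Qed.

End Gauss.

(** * Polynomials in n + 1 variables as univariate polynomials in the last one *)

Section UnivariateView.
Variables (C : fieldType) (n : nat).
Notation widen := (widen_ord (leqnSn n)).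

Definition multi (q : {poly {mpoly C[n]}}) : {mpoly C[n.+1]} :=
  (map_poly (@mwiden n C) q).['X_ord_max].

HB.instance Definition _ := GRing.RMorphism.copy multi
  (horner_eval ('X_ord_max : {mpoly C[n.+1]}) \o map_poly (@mwiden n C)).

Lemma muniXU (i : 'I_n) : muni ('X_(widen i) : {mpoly C[n.+1]}) = ('X_i)%:P.
Proof.
rewrite muniE msuppX big_seq1 mcoeffX eqxx scale1r mnm1E.
have /negbTE -> : widen i != ord_max.
  by rewrite -val_eqE /= neq_ltn ltn_ord.
rewrite expr0 alg_polyC; congr (_%:P); congr ('X_[_]).
by apply/mnmP=> j; rewrite !mnmE.
Qed.

Lemma muniXmax : muni ('X_ord_max : {mpoly C[n.+1]}) = 'X.
Proof.
rewrite muniE msuppX big_seq1 mcoeffX eqxx scale1r mnm1E eqxx expr1.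
rewrite (_ : [multinom _ | _ < n] = 0%MM) ?mpolyX0 ?scale1r //.
apply/mnmP=> j; rewrite !mnmE; apply/eqP; rewrite eqb0 -val_eqE /= neq_ltn.
by rewrite ltn_ord orbT.
Qed.

Lemma muni_mwiden (p : {mpoly C[n]}) : muni (mwiden p) = p%:P.
Proof.
rewrite [p]mpolyE (raddf_sum (@mwiden n C)) (raddf_sum (@muni n C)).
rewrite (raddf_sum (@polyC {mpoly C[n]})); apply: eq_bigr => m _ /=.
rewrite mwidenZ muniZ -mul_polyC -mul_mpolyC polyCM; congr (_ * _).
rewrite mpolyXE_id !rmorph_prod /=; apply: eq_bigr => i _.
by rewrite !rmorphXn /= mwidenX mnmwiden1 muniXU.
Qed.

Lemma multiK : cancel multi (@muni n C).
Proof.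
elim/poly_ind=> [|q c IH]; first by rewrite !rmorph0.
rewrite rmorphD rmorphM /= rmorphD rmorphM /= IH; congr (_ * _ + _).
  by rewrite /multi map_polyX hornerX muniXmax.
by rewrite /multi map_polyC hornerC muni_mwiden.
Qed.

Lemma muniK : cancel (@muni n C) multi.
Proof.
move=> p; rewrite {2}[p]mpolyE {1}[p]mpolyE (raddf_sum (@muni n C)) (raddf_sum multi).
apply: eq_bigr => m _ /=; rewrite muniZ -mul_polyC rmorphM /=.
rewrite {1}/multi map_polyC hornerC /= mwidenC mul_mpolyC; congr (_ *: _).
rewrite mpolyXE_id !rmorph_prod /=; apply: eq_bigr => i _.
rewrite !rmorphXn /=; congr (_ ^+ _); case: (unliftP ord_max i) => [j|] ->.
  rewrite (_ : lift ord_max j = widen j); last by apply: val_inj; rewrite /= /bump leqNgt ltn_ord.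
  by rewrite muniXU /multi map_polyC hornerC /= mwidenX mnmwiden1.
by rewrite muniXmax /multi map_polyX hornerX.
Qed.

Lemma meval_mwiden (v : 'I_n.+1 -> C) (p : {mpoly C[n]}) :
  (mwiden p).@[v] = p.@[fun i => v (widen i)].
Proof.
rewrite [p]mpolyE (raddf_sum (@mwiden n C)) !(raddf_sum (meval _)).
apply: eq_bigr => m _ /=; rewrite mwidenZ !mevalZ mwidenX !mevalX big_ord_recr /= mnmwiden_ordmax.
rewrite expr0 mulr1; congr (_ * _); apply: eq_bigr => i _.
by rewrite mnmwiden_widen.
Qed.

Lemma meval_muni (v : 'I_n.+1 -> C) (p : {mpoly C[n.+1]}) :
  p.@[v] = (map_poly (meval (fun i => v (widen i))) (muni p)).[v ord_max].
Proof.
rewrite -{1}(muniK p) /multi -horner_map /= mevalXU -map_poly_comp /=.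
by congr (_.[_]); apply: eq_map_poly => q /=; apply: meval_mwiden.
Qed.

End UnivariateView.

(** * Transport of divisibility along a ring isomorphism *)

Section Transfer.
Variables (A B : idomainType) (f : {rmorphism A -> B}) (g : {rmorphism B -> A}).
Hypotheses (fK : cancel f g) (gK : cancel g f).

Lemma iso_unit a : (f a \is a GRing.unit) = (a \is a GRing.unit).
Proof.
apply/idP/idP => aU; last exact: rmorph_unit.
by rewrite -(fK a); apply: rmorph_unit.
Qed.

Lemma iso_rdivides a b : rdivides (f a) (f b) <-> rdivides a b.
Proof.
split=> [[q E]|[q ->]]; last by exists (f q); rewrite rmorphM.
by exists (g q); rewrite -(fK b) E rmorphM /= fK.
Qed.

Lemma iso_rirreducible a : rirreducible a -> rirreducible (f a).
Proof.
case=> a0 aU aP; split.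
- by rewrite -(rmorph0 f) (can_eq fK).
- by rewrite iso_unit.
move=> p q E; have : a = g p * g q by rewrite -(fK a) E rmorphM.
by move/aP; rewrite -!iso_unit !gK.
Qed.

Lemma iso_rprime a : rprime (f a) -> rprime a.
Proof.
case=> a0 aU aP; split.
- by apply: contraNneq a0 => ->; rewrite rmorph0.
- by rewrite -iso_unit.
move=> p q; rewrite -!iso_rdivides rmorphM; exact: aP.
Qed.

End Transfer.

Section MPoly.
Variable C : fieldType.

Lemma mpoly_unitE n (p : {mpoly C[n]}) : (p \is a GRing.unit) = (msize p == 1%N).
Proof.
rewrite /in_mem /= /GRing.unit_subdef /= /mpoly_unit unitfE.
apply/andP/eqP => [[/eqP pE p0]|s1].
  by rewrite pE msizeC p0.
have pE : p = (p@_0)%:MP by apply: msize1_polyC; rewrite s1.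
split; first by apply/eqP.
by apply: contra_eqN s1 => /eqP p0; rewrite pE p0 msize0.
Qed.

Lemma mpoly_atomic n : atomic {mpoly C[n]}.
Proof.
move=> a; have [k] := ubnP (msize a); elim: k a => // k IH a sa a0.
have [aU|aU] := boolP (a \is a GRing.unit).
  by exists [::] => //; exists a => //; rewrite big_nil mulr1.
case: (boolp.EM (rirreducible a)) => [aI|aI].
  exists [:: a]; first by move=> p; rewrite inE => /eqP ->.
  by exists 1; rewrite ?unitr1 // big_seq1 mul1r.
have [p [q [aE pU qU]]] : exists p q, [/\ a = p * q, p \isn't a GRing.unit
    & q \isn't a GRing.unit].
  apply/boolp.not_existsP => H; apply: aI; split=> // p q aE.
  have [pU|pU] := boolP (p \is a GRing.unit); first by left.
  have [qU|qU] := boolP (q \is a GRing.unit); first by right.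
  by case: (H p); exists q.
have p0 : p != 0 by apply: contraNneq a0 => p0; rewrite aE p0 mul0r.
have q0 : q != 0 by apply: contraNneq a0 => q0; rewrite aE q0 mulr0.
rewrite !mpoly_unitE in pU qU; move: sa; rewrite aE msizeM // => sa.
have sp := p0; have sq := q0; rewrite -!msize_poly_eq0 in sp sq.
have lt_pred (i j l : nat) : ((i + j).-1 < l.+1 -> i != 0 -> j != 0 -> i != 1 ->
  j != 1 -> (i < l) && (j < l))%N by lia.
have /andP[ltp ltq] := lt_pred _ _ _ sa sp sq pU qU.
have [//|//|s sI [u uU ->]] := IH p.
have [//|//|s' sI' [u' uU' ->]] := IH q.
exists (s ++ s'); first by move=> r; rewrite mem_cat => /orP[/sI|/sI'].
by exists (u * u'); rewrite ?unitrM ?uU // big_cat /=; ring.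
Qed.

(** Induction on the number of variables, Gauss's lemma being applied to the last one. With no
    variable, every nonzero polynomial is a unit. *)
Lemma mpoly_irreducible_prime n (f : {mpoly C[n]}) : rirreducible f -> rprime f.
Proof.
elim: n f => [|n IH] f fI.
  case: fI => f0 /negP[]; rewrite mpoly_unitE.
  rewrite eqn_leq lt0n msize_poly_eq0 f0 andbT.
  rewrite msizeE; apply/bigmax_leqP_seq => m _ _.
  by rewrite (_ : m = 0%MM) ?mdeg0 //; apply/mnmP => -[].
apply: (iso_rprime (@muniK C n)).
apply: (poly_irreducible_prime IH); first exact: mpoly_atomic.
exact: (iso_rirreducible (@muniK C n) (@multiK C n)).
Qed.

End MPoly.

(** * Nullstellensatz for hypersurfaces *)

Section Nullstellensatz.
Variable C : closedFieldType.

Lemma extend_point n (v : 'I_n -> C) (z : C) : exists w : 'I_n.+1 -> C,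
  (fun i => w (widen_ord (leqnSn n) i)) =1 v /\ w ord_max = z.
Proof.
exists (fun i => if unlift ord_max i is Some j then v j else z).
split=> [i|]; last by rewrite unlift_none.
rewrite (_ : widen_ord _ i = lift ord_max i) ?liftK //.
by apply: val_inj; rewrite /= /bump leqNgt ltn_ord.
Qed.

Lemma meval_extend n (v : 'I_n -> C) (z : C) : exists w : 'I_n.+1 -> C,
  forall p : {mpoly C[n.+1]}, p.@[w] = (map_poly (meval v) (muni p)).[z].
Proof.
have [w [wv wz]] := extend_point v z; exists w => p.
rewrite meval_muni wz; congr (_.[_]); apply: eq_map_poly => q.
exact: meval_eq.
Qed.

Lemma mpoly_nonroot n (p : {mpoly C[n]}) : p != 0 -> exists v, p.@[v] != 0.
Proof.
elim: n p => [|n IH] p p0.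
  exists (fun=> 0); apply: contraNneq p0 => pv.
  have pE : p = (p@_0)%:MP.
    apply: msize1_polyC; rewrite msizeE; apply/bigmax_leqP_seq => m _ _.
    by rewrite (_ : m = 0%MM) ?mdeg0 //; apply/mnmP => -[].
  by move: pv; rewrite pE mevalC => ->.
have P0 : muni p != 0 by rewrite -(rmorph0 (@muni n C)) (can_eq (@muniK C n)).
have [|v vP] := IH (lead_coef (muni p)); first by rewrite lead_coef_eq0.
have : map_poly (meval v) (muni p) != 0.
  apply: contraNneq vP => E; have := congr1 (fun r : {poly C} => r`_(size (muni p)).-1) E.
  by rewrite coef_map coef0 lead_coefE => ->.
case/closed_nonrootP => z zP; have [w wP] := meval_extend v z.
by exists w; rewrite wP.
Qed.

(** Induction on the number of variables. If [f] does not involve the last one, it divides each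
    coefficient of [g]. Otherwise it divides [g] or is coprime to it, and a Bezout relation excludes
    the second case: it yields a nonzero polynomial in the other variables that vanishes under every
    common zero. *)
Lemma mpoly_nullstellensatz n (f g : {mpoly C[n]}) : rirreducible f ->
  (forall v, f.@[v] = 0 -> g.@[v] = 0) -> rdivides f g.
Proof.
elim: n f g => [|n IH] f g fI fg.
  case: fI => f0 /negP[]; rewrite mpoly_unitE.
  rewrite eqn_leq lt0n msize_poly_eq0 f0 andbT.
  rewrite msizeE; apply/bigmax_leqP_seq => m _ _.
  by rewrite (_ : m = 0%MM) ?mdeg0 //; apply/mnmP => -[].
apply/(iso_rdivides (@muniK C n)); suff : rdivides (muni f) (muni g) by [].
have FI : rirreducible (muni f) := iso_rirreducible (@muniK C n) (@multiK C n) fI.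
have vanish (v : 'I_n -> C) z : (map_poly (meval v) (muni f)).[z] = 0 ->
    (map_poly (meval v) (muni g)).[z] = 0.
  by have [w wP] := meval_extend v z; have := fg w; rewrite (wP f) (wP g).
move: (muni f) (muni g) FI vanish => F G FI vanish.
have [F0 _ _] := FI.
have prim := @mpoly_irreducible_prime C n.
have atom := @mpoly_atomic C n.
case: (leqP (size F) 1) => [|sF].
  move=> /size1_polyC FE; rewrite FE in FI vanish *.
  move: (F`_0) FI vanish => c /rirreducible_polyC cI vanish.
  have cG i : rdivides c G`_i.
    apply: IH => // v cv.
    have : map_poly (meval v) G == 0.
      apply/negPn/negP => /closed_nonrootP[z] /negP[]; apply/eqP/vanish.
      by rewrite map_polyC hornerC.
    by move/eqP/(congr1 (fun r : {poly C} => r`_i)); rewrite coef_map coef0.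
  exact: rdivides_polyC.
have [cop|//] := irreducible_coprimep prim atom G FI sF.
have /Pdiv.Idomain.Bezout_coprimepP[[U V]] := cop.
case/Pdiv.Idomain.eqpP => -[c1 c2] /= /andP[c10 c20] E.
(* Over such a [v], [F] keeps its positive degree and so has a root, where [G] vanishes too, while
   the constant [c2] of the Bezout relation does not. *)
have [|v] := mpoly_nonroot (p := c2 * lead_coef F).
  by rewrite mulf_neq0 // lead_coef_eq0.
rewrite mevalM mulf_eq0 negb_or => /andP[c2v lFv].
have sFv : size (map_poly (meval v) F) = size F.
  by apply: size_poly_eq; rewrite -lead_coefE.
have [z] : exists z, root (map_poly (meval v) F) z.
  by apply/closed_rootP; rewrite sFv gtn_eqF.
move=> /eqP zF; have zG := vanish _ _ zF.
have := congr1 (fun r => (map_poly (meval v) r).[z]) E.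
rewrite -!mul_polyC !rmorphM /= !rmorphD !rmorphM /= !hornerM hornerD !hornerM.
rewrite zF zG !mulr0 addr0 mulr0 rmorph1 hornerC mulr1 map_polyC hornerC => /esym E0.
by rewrite /= E0 eqxx in c2v.
Qed.

(** An irreducible factor of [g] vanishes only at zeros of [f], so it divides [f] and is associate
    to it. An exponent 0 would leave [f] without zeros, hence a divisor of 1. *)
Lemma same_zeros_power n (f g : {mpoly C[n]}) : rirreducible f -> g != 0 ->
  (forall v, f.@[v] = 0 <-> g.@[v] = 0) ->
  exists (l : C) (k : nat), [/\ l != 0, (1 <= k)%N & g = l *: f ^+ k].
Proof.
move=> fI g0 fg; have [f0 fU _] := fI.
suff [l [k [l0 gE]]] : exists (l : C) (k : nat), l != 0 /\ g = l *: f ^+ k.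
  exists l, k; split=> //; case: k gE => // gE; rewrite expr0 in gE.
  case/negP: fU; apply/unitrP.
  have [|q qE] := mpoly_nullstellensatz (g := 1) fI.
    move=> v /fg; rewrite gE mevalZ meval1 mulr1 => l_eq0.
    by rewrite l_eq0 eqxx in l0.
  by exists q; rewrite [f * q]mulrC -qE.
have [s sI [u uU gE]] := mpoly_atomic g0.
have sE : {in s, forall p, exists2 q, q \is a GRing.unit & p = q * f}.
  move=> p ps; have pI := sI _ ps.
  have [q fE] : rdivides p f.
    apply: mpoly_nullstellensatz => // v pv; apply/fg.
    by rewrite gE mevalM (big_rem p) //= mevalM pv mul0r mulr0.
  have [_ _ fP] := fI; have [qU|pU] := fP _ _ fE.
    by exists q^-1; rewrite ?unitrV // fE mulKr.
  by case: pI => _ /negP.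
have [w wU E] : exists2 w, w \is a GRing.unit & \prod_(p <- s) p = w * f ^+ size s.
  elim: s sE {gE sI} => [|p s IH] sE.
    by exists 1; rewrite ?unitr1 // big_nil expr0 mulr1.
  have [q qU pE] := sE p (mem_head _ _).
  have [|w wU E] := IH; first by move=> r rs; apply: sE; rewrite inE rs orbT.
  by exists (q * w); rewrite ?unitrM ?qU // big_cons E {1}pE /= exprS; ring.
have : u * w \is a GRing.unit by rewrite unitrM uU.
rewrite mpoly_unitE => /msize_poly1P[l l0 lE].
by exists l, (size s); split=> //; rewrite gE E mulrA lE mul_mpolyC.
Qed.

End Nullstellensatz.

(** * Bezoutian syzygies of three univariate polynomials *)

Lemma size_drop_poly_le (R : nzRingType) m (f : {poly R}) i :
  (size f <= m)%N -> (size (drop_poly i f) <= m - i)%N.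
Proof. by move=> sf; rewrite size_drop_poly leq_sub2r. Qed.

Definition coprime3 (k : fieldType) (f1 f2 f3 : {poly k}) :=
  exists g1 g2 g3, g1 * f1 + g2 * f2 + g3 * f3 = 1.

Section Bezoutian.
Variables (k : fieldType) (n : nat).
Implicit Types (f g w h : {poly k}) (c : 'I_n -> k).

(* With c the functional t'^i |-> c i, this is c applied in t' to the divided
   difference (f(t) - f(t')) / (t - t'). *)
Definition divdiff c f := \sum_(i < n) c i *: drop_poly i.+1 f.

Lemma size_divdiff c f : (size f <= n.+1)%N -> (size (divdiff c f) <= n)%N.
Proof.
move=> sf; apply: (leq_trans (size_sum _ _ _)); apply/bigmax_leqP => i _.
apply: leq_trans (size_scale_leq _ _) _.
by apply: leq_trans (size_drop_poly_le _ sf) _; lia.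
Qed.

(** Split [f] and [g] into their terms of degree at most [i] and the rest. The products of two high
    parts cancel, and the others have degree at most i + (n - i - 1). *)
Lemma size_bezoutian1 i f g : (i < n)%N ->
  (size f <= n.+1)%N -> (size g <= n.+1)%N ->
  (size (f * drop_poly i.+1 g - g * drop_poly i.+1 f)%R <= n)%N.
Proof.
move=> ltin sf sg.
have -> : f * drop_poly i.+1 g - g * drop_poly i.+1 f =
    take_poly i.+1 f * drop_poly i.+1 g - take_poly i.+1 g * drop_poly i.+1 f.
  by rewrite -{1}(poly_take_drop i.+1 f) -{2}(poly_take_drop i.+1 g); ring.
have aux f1 g1 : (size g1 <= n.+1)%N ->
    (size (take_poly i.+1 f1 * drop_poly i.+1 g1)%R <= n)%N.
  move=> sg1; apply: leq_trans (size_polyMleq _ _) _.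
  move: (size_take_poly i.+1 f1) (size_drop_poly_le i.+1 sg1).
  by move: (size _) (size _) => d1 d2; lia.
apply: leq_trans (size_polyD _ _) _; rewrite geq_max size_polyN.
by rewrite !aux.
Qed.

Lemma size_bezoutian c f g : (size f <= n.+1)%N -> (size g <= n.+1)%N ->
  (size (f * divdiff c g - g * divdiff c f)%R <= n)%N.
Proof.
move=> sf sg; rewrite /divdiff !mulr_sumr -sumrB.
apply: (leq_trans (size_sum _ _ _)); apply/bigmax_leqP => i _.
rewrite -!scalerAr -scalerBr; apply: leq_trans (size_scale_leq _ _) _.
exact: size_bezoutian1.
Qed.

(** The system is triangular: the coefficient of degree n - 1 - i involves [c] only at indices up to
    [i], with the leading coefficient of [f] on the diagonal. *)
Lemma divdiff_inj c f : size f = n.+1 -> divdiff c f = 0 -> c =1 fun=> 0.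
Proof.
move=> sf cf0 i; have fn0 : f`_n != 0.
  by have := lead_coef_eq0 f; rewrite lead_coefE sf -size_poly_eq0 sf => ->.
have [j] := ubnP (i : nat); elim: j i => // j IH i ltij.
have := congr1 (fun p : {poly k} => p`_(n.-1 - i)) cf0.
rewrite coef0 coef_sum (bigD1 i) //= coefZ coef_drop_poly big1 ?addr0 => [|l li].
  rewrite (_ : (n.-1 - i + i.+1)%N = n); last by have := ltn_ord i; lia.
  by move=> /eqP; rewrite mulf_eq0 (negbTE fn0) orbF => /eqP.
rewrite coefZ coef_drop_poly; have [lti|gei] := ltnP l i.
  by rewrite IH ?mul0r // (leq_trans lti) // -ltnS.
rewrite [f`__]nth_default ?mulr0 // sf.
by move: li gei; rewrite -val_eqE /= => ? ?; have := ltn_ord l; lia.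
Qed.

Lemma divdiff_surj f w : size f = n.+1 -> (size w <= n)%N ->
  exists c, w = divdiff c f.
Proof.
move=> sf; have fn0 : f`_n != 0.
  by have := lead_coef_eq0 f; rewrite lead_coefE sf -size_poly_eq0 sf => ->.
suff H r : (r <= n)%N -> (size w <= r)%N -> exists c, w = divdiff c f by apply: H.
elim: r w => [|r IH] w lern sw.
  exists (fun=> 0); rewrite /divdiff big1 => [|i _]; last by rewrite scale0r.
  by apply/eqP; rewrite -size_poly_leq0.
have lti : (n - r.+1 < n)%N by lia.
(* [drop_poly i0.+1 f] has degree exactly [r], so subtracting [a] times it kills the top coefficient
   of [w]. *)
pose i0 := Ordinal lti; pose a := w`_r / f`_n.
have [||c cE] := IH (w - a *: drop_poly i0.+1 f); first exact: ltnW.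
  apply/leq_sizeP => j lerj; rewrite coefB coefZ coef_drop_poly.
  have [->|njr] := eqVneq j r.
    by rewrite (_ : (r + i0.+1)%N = n) ?divfK ?subrr //=; lia.
  rewrite nth_default; last by apply: leq_trans sw _; lia.
  by rewrite nth_default ?mulr0 ?subrr // sf /=; lia.
exists (fun i => c i + (i == i0)%:R * a).
rewrite -[LHS](subrK (a *: drop_poly i0.+1 f)) cE /divdiff.
rewrite [in RHS](eq_bigr (fun i : 'I_n => c i *: drop_poly i.+1 f +
   ((i == i0)%:R * a) *: drop_poly i.+1 f)); last by move=> i _; rewrite scalerDl.
rewrite big_split /=; congr (_ + _).
rewrite (bigD1 i0) //= eqxx mul1r big1 ?addr0 // => i /negbTE ->.
by rewrite mul0r scale0r.
Qed.

(** The equations make the divided differences proportional to the three polynomials, and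
    coprimality makes the factor a polynomial [h]. Divided differences have degree below [n], so
    comparison with a polynomial of degree [n] gives [h] = 0. *)
Lemma bezoutian_indep (f1 f2 f3 : {poly k}) c :
  (size f1 <= n.+1)%N -> (size f2 <= n.+1)%N -> (size f3 <= n.+1)%N ->
  [|| size f1 == n.+1, size f2 == n.+1 | size f3 == n.+1] ->
  coprime3 f1 f2 f3 ->
  f2 * divdiff c f3 = f3 * divdiff c f2 -> f3 * divdiff c f1 = f1 * divdiff c f3 ->
  f1 * divdiff c f2 = f2 * divdiff c f1 -> c =1 fun=> 0.
Proof.
move=> s1 s2 s3 top [g1 [g2 [g3 gE]]] E1 E2 E3.
pose h := g1 * divdiff c f1 + g2 * divdiff c f2 + g3 * divdiff c f3.
have h1 : divdiff c f1 = h * f1.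
  rewrite -[LHS]mul1r -gE /h !mulrDl -!mulrA E2 -E3; ring.
have h2 : divdiff c f2 = h * f2.
  rewrite -[LHS]mul1r -gE /h !mulrDl -!mulrA E3 -E1; ring.
have h3 : divdiff c f3 = h * f3.
  rewrite -[LHS]mul1r -gE /h !mulrDl -!mulrA E1 -E2; ring.
have aux f : size f == n.+1 -> divdiff c f = h * f -> c =1 fun=> 0.
  move=> /eqP sf fE; apply: (divdiff_inj sf).
  have := size_divdiff c (eq_leq sf); rewrite fE.
  have [->|h0] := eqVneq h 0; first by rewrite mul0r.
  have f0 : f != 0 by rewrite -size_poly_eq0 sf.
  rewrite size_mul // sf addnS /= -{2}[n]add0n leq_add2r leqn0.
  by rewrite size_poly_eq0 (negbTE h0).
by case/or3P: top => /aux H; [apply: (H h1)|apply: (H h2)|apply: (H h3)].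
Qed.

(** Koszul exactness: as f.g = 1 and a.f = 0, the vector a is the cross product of f with w = a x g.
    Only w modulo f matters, so its first entry can be reduced below degree [n], where it is a
    divided difference by [divdiff_surj]. *)
Lemma bezoutian_span1 (f1 f2 f3 a1 a2 a3 : {poly k}) :
  size f1 = n.+1 -> (size f2 <= n.+1)%N -> (size f3 <= n.+1)%N ->
  coprime3 f1 f2 f3 ->
  (size a1 <= n)%N -> (size a2 <= n)%N -> (size a3 <= n)%N ->
  a1 * f1 + a2 * f2 + a3 * f3 = 0 ->
  exists c, [/\ a1 = f2 * divdiff c f3 - f3 * divdiff c f2,
    a2 = f3 * divdiff c f1 - f1 * divdiff c f3 &
    a3 = f1 * divdiff c f2 - f2 * divdiff c f1].
Proof.
move=> s1 s2 s3 [g1 [g2 [g3 gE]]] sa1 sa2 sa3 aE.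
have f10 : f1 != 0 by rewrite -size_poly_eq0 s1.
pose q := (a2 * g3 - a3 * g2) %/ f1.
pose w1 := (a2 * g3 - a3 * g2) - q * f1.
pose w2 := (a3 * g1 - a1 * g3) - q * f2.
pose w3 := (a1 * g2 - a2 * g1) - q * f3.
have sw1 : (size w1 <= n)%N.
  have -> : w1 = (a2 * g3 - a3 * g2) %% f1.
    by rewrite /w1 [X in X - _](divp_eq _ f1) addrAC subrr add0r.
  by have := ltn_modp (a2 * g3 - a3 * g2) f1; rewrite f10 s1 ltnS.
have [c w1E] := divdiff_surj s1 sw1; exists c.
have E1 : a1 = f2 * w3 - f3 * w2.
  transitivity (a1 * (g1 * f1 + g2 * f2 + g3 * f3) - g1 * (a1 * f1 + a2 * f2 + a3 * f3)).
    by rewrite gE aE; ring.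
  rewrite /w2 /w3; ring.
have E2 : a2 = f3 * w1 - f1 * w3.
  transitivity (a2 * (g1 * f1 + g2 * f2 + g3 * f3) - g2 * (a1 * f1 + a2 * f2 + a3 * f3)).
    by rewrite gE aE; ring.
  rewrite /w1 /w3; ring.
have E3 : a3 = f1 * w2 - f2 * w1.
  transitivity (a3 * (g1 * f1 + g2 * f2 + g3 * f3) - g3 * (a1 * f1 + a2 * f2 + a3 * f3)).
    by rewrite gE aE; ring.
  rewrite /w1 /w2; ring.
(* Since [f1] has degree [n], this forces the other two entries of w to be divided differences with
   the same [c]. *)
have zero d : (size (f1 * d)%R <= n)%N -> d = 0.
  have [//|d0] := eqVneq d 0.
  rewrite size_mul // s1 addSn /= -{2}[n]addn0 leq_add2l leqn0.
  by rewrite size_poly_eq0 (negbTE d0).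
have le1 := eq_leq s1.
have w2E : w2 = divdiff c f2.
  apply/eqP; rewrite -subr_eq0; apply/eqP/zero.
  have -> : f1 * (w2 - divdiff c f2) = a3 - (f1 * divdiff c f2 - f2 * divdiff c f1).
    by rewrite E3 w1E; ring.
  apply: leq_trans (size_polyD _ _) _; rewrite geq_max sa3 size_polyN.
  exact: size_bezoutian.
have w3E : w3 = divdiff c f3.
  apply/eqP; rewrite -subr_eq0; apply/eqP/zero.
  have -> : f1 * (w3 - divdiff c f3) = - a2 - (f1 * divdiff c f3 - f3 * divdiff c f1).
    by rewrite E2 w1E; ring.
  apply: leq_trans (size_polyD _ _) _; rewrite geq_max !size_polyN sa2.
  exact: size_bezoutian.
by rewrite -w1E -w2E -w3E.
Qed.

Lemma bezoutian_span (f1 f2 f3 a1 a2 a3 : {poly k}) :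
  (size f1 <= n.+1)%N -> (size f2 <= n.+1)%N -> (size f3 <= n.+1)%N ->
  [|| size f1 == n.+1, size f2 == n.+1 | size f3 == n.+1] ->
  coprime3 f1 f2 f3 ->
  (size a1 <= n)%N -> (size a2 <= n)%N -> (size a3 <= n)%N ->
  a1 * f1 + a2 * f2 + a3 * f3 = 0 ->
  exists c, [/\ a1 = f2 * divdiff c f3 - f3 * divdiff c f2,
    a2 = f3 * divdiff c f1 - f1 * divdiff c f3 &
    a3 = f1 * divdiff c f2 - f2 * divdiff c f1].
Proof.
move=> s1 s2 s3 top [g1 [g2 [g3 gE]]] sa1 sa2 sa3 aE.
case/or3P: top => /eqP sE.
- by apply: bezoutian_span1 => //; exists g1, g2, g3.
- have [||c [-> -> ->]] := bezoutian_span1 sE s3 s1 _ sa2 sa3 sa1; last by exists c.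
    by exists g2, g3, g1; rewrite -gE; ring.
  by rewrite -aE; ring.
- have [||c [-> -> ->]] := bezoutian_span1 sE s1 s2 _ sa3 sa1 sa2; last by exists c.
    by exists g3, g1, g2; rewrite -gE; ring.
  by rewrite -aE; ring.
Qed.

End Bezoutian.

Lemma coprime3_closed (k : closedFieldType) (f1 f2 f3 : {poly k}) :
  (forall z, ~ [/\ root f1 z, root f2 z & root f3 z]) -> coprime3 f1 f2 f3.
Proof.
move=> H.
have cop : coprimep f1 (gcdp f2 f3).
  rewrite /coprimep; apply/negPn/negP => /closed_rootP [z].
  by rewrite !root_gcd => /and3P[z1 z2 z3]; apply: (H z).
have /Bezout_eq1_coprimepP[[u v] /= E] := cop.
have [[p q] /= pq] := Bezoutp f2 f3.
have /eqpP[[c1 c2] /= /andP[c10 c20] E2] := pq.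
exists u, (v * c2^-1%:P * c1%:P * p), (v * c2^-1%:P * c1%:P * q); rewrite -E -addrA; congr (_ + _).
have : c2^-1%:P * (c1%:P * (p * f2 + q * f3)) = gcdp f2 f3.
  by rewrite [c1%:P * _]mul_polyC E2 mul_polyC scalerA mulVf // scale1r.
by move=> <-; ring.
Qed.

(** * Generation by three bi-homogeneous forms *)

Section Bipoly.
Variable k : fieldType.
Notation bipoly := {poly {poly k}}.

(* In {poly {poly k}} the outer variable is s and the inner one is t; a form of
   bi-degree (a, b) in (s, u; t, v) is represented by its value at u = v = 1. *)
Definition bounded (a b : nat) (q : bipoly) :=
  (size q <= a)%N /\ forall i, (size (q`_i)%R <= b)%N.

Lemma bounded0 a b : bounded a b 0.
Proof. by split=> [|i]; rewrite ?coef0 size_poly0. Qed.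

Lemma boundedD a b p q : bounded a b p -> bounded a b q -> bounded a b (p + q).
Proof.
move=> [sp tp] [sq tq]; split=> [|i]; last rewrite coefD;
  by apply: leq_trans (size_polyD _ _) _; rewrite geq_max ?sp ?sq ?tp ?tq.
Qed.

Lemma bounded_sum a b (I : finType) (F : I -> bipoly) :
  (forall i, bounded a b (F i)) -> bounded a b (\sum_i F i).
Proof.
move=> FP; elim/big_rec: _ => [|i p _ pP]; first exact: bounded0.
exact: boundedD.
Qed.

Lemma boundedZ a b (c : k) p : bounded a b p -> bounded a b (c%:P *: p).
Proof.
case=> sp tp; split=> [|i]; first exact: leq_trans (size_scale_leq _ _) sp.
by rewrite coefZ mul_polyC; apply: leq_trans (size_scale_leq _ _) (tp i).
Qed.

Lemma boundedM a b c d p q : bounded a.+1 b.+1 p -> bounded c d q ->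
  bounded (a + c) (b + d) (p * q).
Proof.
move=> [sp tp] [sq tq]; split=> [|i].
  by apply: leq_trans (size_polyMleq _ _) _; lia.
rewrite coefM; apply: (leq_trans (size_sum _ _ _)); apply/bigmax_leqP => j _.
apply: leq_trans (size_polyMleq _ _) _.
by have := tp j; have := tq (i - j)%N; lia.
Qed.

Section Matrices.
Variables a b : nat.

(** Coefficient matrices provide the finite-dimensional spaces in which dimensions are counted;
    [insub] turns natural indices into ordinals. *)
Definition of_mx (M : 'M[k]_(a, b)) : bipoly :=
  \poly_(i < a) \poly_(j < b)
    (if insub i is Some i' then if insub j is Some j' then M i' j' else 0 else 0).

Definition to_mx (q : bipoly) : 'M[k]_(a, b) := \matrix_(i, j) q`_i`_j.

Lemma of_mxE M (i : 'I_a) (j : 'I_b) : (of_mx M)`_i`_j = M i j.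
Proof. by rewrite coef_poly ltn_ord coef_poly ltn_ord !valK. Qed.

Lemma bounded_of_mx M : bounded a b (of_mx M).
Proof.
split=> [|i]; first exact: size_poly.
by rewrite coef_poly; case: ifP => _; rewrite ?size_poly ?size_poly0.
Qed.

Lemma bounded_eqP p q : bounded a b p -> bounded a b q ->
  (forall (i : 'I_a) (j : 'I_b), p`_i`_j = q`_i`_j) -> p = q.
Proof.
move=> [sp tp] [sq tq] E; apply/polyP => i.
have [lti|gei] := ltnP i a; last by rewrite !nth_default // (leq_trans _ gei).
apply/polyP => j; have [ltj|gej] := ltnP j b.
  exact: (E (Ordinal lti) (Ordinal ltj)).
by rewrite [LHS]nth_default ?[RHS]nth_default ?(leq_trans _ gej).
Qed.

Lemma of_mxK : cancel of_mx to_mx.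
Proof. by move=> M; apply/matrixP => i j; rewrite mxE of_mxE. Qed.

Lemma to_mxK q : bounded a b q -> of_mx (to_mx q) = q.
Proof.
move=> qP; apply: (bounded_eqP (bounded_of_mx _) qP) => i j.
by rewrite of_mxE mxE.
Qed.

Lemma to_mx_is_linear (c : k) p q : to_mx (c%:P *: p + q) = c *: to_mx p + to_mx q.
Proof. by apply/matrixP => i j; rewrite !mxE coefD coefZ coefD coefCM. Qed.

Lemma of_mx_is_linear (c : k) M N : of_mx (c *: M + N) = c%:P *: of_mx M + of_mx N.
Proof.
apply: (bounded_eqP (bounded_of_mx _)).
  by apply: boundedD; first apply: boundedZ; apply: bounded_of_mx.
by move=> i j; rewrite coefD coefZ coefD coefCM !of_mxE !mxE.
Qed.

Lemma of_mx0 : of_mx 0 = 0.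
Proof. by have := of_mx_is_linear (-1) 0 0; rewrite scaler0 addr0 polyCN scaleN1r addNr. Qed.

Lemma of_mx_sum (I : finType) (c : I -> k) (M : I -> 'M[k]_(a, b)) :
  of_mx (\sum_i c i *: M i) = \sum_i (c i)%:P *: of_mx (M i).
Proof.
elim/big_rec2: _ => [|i N p _ <-]; first exact: of_mx0.
by rewrite of_mx_is_linear.
Qed.

End Matrices.

Lemma coefM_top (R : nzRingType) a b (p q : {poly R}) :
  (size p <= a.+1)%N -> (size q <= b.+1)%N -> (p * q)`_(a + b) = p`_a * q`_b.
Proof.
move=> sp sq; rewrite coefM.
have la : (a < (a + b).+1)%N by rewrite ltnS leq_addr.
rewrite (bigD1 (Ordinal la)) //= addKn big1 ?addr0 // => i.
rewrite -val_eqE /= => ia; have [lt|ge] := ltnP a i.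
  by rewrite [p`__]nth_default ?mul0r // (leq_trans sp).
by rewrite [q`__]nth_default ?mulr0 // (leq_trans sq) //; lia.
Qed.

(** * Bezoutian syzygies with s as a parameter *)

Section Bezoutian2.
Variables (m n : nat).

(** The coefficient of t'^i in (y(t') z(t) - y(t) z(t')) / (t - t'). *)
Definition bez (i : nat) (y z : bipoly) : bipoly :=
  y * map_poly (drop_poly i.+1) z - z * map_poly (drop_poly i.+1) y.

Lemma bounded_bez (i : 'I_n) y z : bounded m.+1 n.+1 y -> bounded m.+1 n.+1 z ->
  bounded (2 * m).+1 n (bez i y z).
Proof.
move=> [sy ty] [sz tz]; split=> [|r].
  have sd (p q : bipoly) : (size p <= m.+1)%N -> (size q <= m.+1)%N ->
    (size (p * map_poly (drop_poly i.+1) q)%R <= (2 * m).+1)%N.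
    move=> sp sq; apply: leq_trans (size_polyMleq _ _) _.
    have : (size (map_poly (drop_poly i.+1) q) <= m.+1)%N.
      exact: leq_trans (size_poly _ _) sq.
    by move: (size _) (size _) sp => d1 d2; lia.
  apply: leq_trans (size_polyD _ _) _.
  by rewrite geq_max size_polyN !sd.
rewrite /bez coefB coefM coefMr -sumrB.
apply: (leq_trans (size_sum _ _ _)); apply/bigmax_leqP => j _.
rewrite !coef_map_id0 ?drop_poly0r //.
exact: size_bezoutian1.
Qed.

Lemma coef_bez_top i y z : bounded m.+1 n.+1 y -> bounded m.+1 n.+1 z ->
  (bez i y z)`_(2 * m) = y`_m * drop_poly i.+1 z`_m - z`_m * drop_poly i.+1 y`_m.
Proof.
move=> [sy _] [sz _]; rewrite mul2n -addnn coefB !coefM_top //.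
- by rewrite !coef_map_id0 ?drop_poly0r.
- by apply: leq_trans sy; apply: size_poly.
- by apply: leq_trans sz; apply: size_poly.
Qed.

Lemma horner_drop i (y : bipoly) (l : k) :
  (map_poly (drop_poly i) y).[l%:P] = drop_poly i y.[l%:P].
Proof.
rewrite (horner_coef_wide _ (size_poly _ _)) horner_coef drop_poly_sum.
apply: eq_bigr => j _; rewrite coef_map_id0 ?drop_poly0r //.
by rewrite -polyC_exp mulrC mul_polyC [in RHS]mulrC mul_polyC drop_polyZ.
Qed.

Lemma horner_bez i y z l : (bez i y z).[l%:P] =
  y.[l%:P] * drop_poly i.+1 z.[l%:P] - z.[l%:P] * drop_poly i.+1 y.[l%:P].
Proof. by rewrite hornerD hornerN !hornerM !horner_drop. Qed.

Lemma sum_bezoutian (c : 'I_n -> k) (f g : {poly k}) :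
  \sum_(i < n) (c i)%:P * (f * drop_poly i.+1 g - g * drop_poly i.+1 f) =
  f * divdiff c g - g * divdiff c f.
Proof.
rewrite /divdiff !mulr_sumr -sumrB; apply: eq_bigr => i _.
by rewrite -!mul_polyC; ring.
Qed.

(** Seen as forms of degree [n], the three polynomials have no common zero on P^1: the sizes exclude
    infinity, the Bezout identity excludes the affine points. *)
Definition spread (f1 f2 f3 : {poly k}) :=
  [|| size f1 == n.+1, size f2 == n.+1 | size f3 == n.+1] /\ coprime3 f1 f2 f3.

Lemma size_horner_bounded a b (q : bipoly) l : bounded a b q ->
  (size q.[l%:P] <= b)%N.
Proof.
case=> sq tq; rewrite horner_coef; apply: (leq_trans (size_sum _ _ _)).
apply/bigmax_leqP => j _; rewrite -polyC_exp mulrC mul_polyC.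
exact: leq_trans (size_scale_leq _ _) (tq j).
Qed.

Variables y1 y2 y3 : bipoly.
Hypotheses (y1P : bounded m.+1 n.+1 y1) (y2P : bounded m.+1 n.+1 y2)
  (y3P : bounded m.+1 n.+1 y3).
Hypothesis spread_horner : forall l : k, spread y1.[l%:P] y2.[l%:P] y3.[l%:P].
Hypothesis spread_infty : spread y1`_m y2`_m y3`_m.

Definition syzygy (a1 a2 a3 : bipoly) :=
  [/\ bounded (2 * m) n a1, bounded (2 * m) n a2, bounded (2 * m) n a3 &
      a1 * y1 + a2 * y2 + a3 * y3 = 0].

(** Multiplication by s creates a coefficient of s^(2m), which is a syzygy of the forms at s =
    infinity. By [bezoutian_span] it comes from some constants [c], and the same combination of
    Bezoutian syzygies cancels it. *)
Lemma syzygy_step a1 a2 a3 : syzygy a1 a2 a3 -> exists c : 'I_n -> k,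
  syzygy (a1 * 'X - \sum_i (c i)%:P *: bez i y2 y3)
         (a2 * 'X - \sum_i (c i)%:P *: bez i y3 y1)
         (a3 * 'X - \sum_i (c i)%:P *: bez i y1 y2).
Proof.
case=> a1P a2P a3P aE.
have [top cop] := spread_infty.
have topE : a1`_(2 * m).-1 * y1`_m + a2`_(2 * m).-1 * y2`_m +
    a3`_(2 * m).-1 * y3`_m = 0.
  have := congr1 (fun p : bipoly => p`_((2 * m).-1 + m)) aE.
  rewrite !coefD !coefM_top ?coef0 //;
    by [case: y1P|case: y2P|case: y3P|apply: leq_trans (proj1 a1P) _; lia
       |apply: leq_trans (proj1 a2P) _; lia|apply: leq_trans (proj1 a3P) _; lia].
have [c [E1 E2 E3]] := bezoutian_span (proj2 y1P m) (proj2 y2P m) (proj2 y3P m)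
  top cop (proj2 a1P _) (proj2 a2P _) (proj2 a3P _) topE.
have boundstep a y z : bounded (2 * m) n a -> bounded m.+1 n.+1 y ->
    bounded m.+1 n.+1 z ->
    a`_(2 * m).-1 = y`_m * divdiff c z`_m - z`_m * divdiff c y`_m ->
    bounded (2 * m) n (a * 'X - \sum_i (c i)%:P *: bez i y z).
  move=> aP yP zP E.
  have sumP : bounded (2 * m).+1 n (- \sum_i (c i)%:P *: bez i y z).
    rewrite -scaleN1r -polyCN; apply/boundedZ/bounded_sum => i.
    exact/boundedZ/bounded_bez.
  have aXP : bounded (2 * m).+1 n (a * 'X).
    case: aP => sa ta; split=> [|i]; last first.
      by rewrite coefMX; case: i => [|i] /=; rewrite ?size_poly0.
    by apply: leq_trans (size_polyMleq _ _) _; rewrite size_polyX addn2.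
  have [sd td] := boundedD aXP sumP; split=> //.
  apply/leq_sizeP => j; rewrite leq_eqVlt => /orP[/eqP <-|ltj]; last first.
    by rewrite nth_default // (leq_trans sd).
  rewrite coefB coef_sum coefMX.
  under eq_bigr => i _ do rewrite coefZ (coef_bez_top _ yP zP).
  (* If [m] is 0, the index [(2 * m).-1] is truncated to 0; then [a] is zero by its bound. *)
  rewrite sum_bezoutian -E; case: eqP => [m0|]; rewrite ?subrr //.
  by rewrite sub0r nth_default ?oppr0 // m0; case: aP; rewrite m0.
exists c; split; try exact: boundstep.
transitivity ('X * (a1 * y1 + a2 * y2 + a3 * y3) - \sum_(i < n) (c i)%:P *:
  (bez i y2 y3 * y1 + bez i y3 y1 * y2 + bez i y1 y2 * y3)).
  under [in RHS]eq_bigr => i _ do rewrite !scalerDr !scalerAl.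
  by rewrite !big_split /= -!mulr_suml; ring.
rewrite aE mulr0 sub0r big1 ?oppr0 // => i _.
by rewrite /bez (_ : _ + _ = 0) ?scaler0 //; ring.
Qed.

Lemma bez_indep (c : 'I_n -> k) a1 a2 a3 (l : k) :
  a1 * ('X - l%:P%:P) = \sum_i (c i)%:P *: bez i y2 y3 ->
  a2 * ('X - l%:P%:P) = \sum_i (c i)%:P *: bez i y3 y1 ->
  a3 * ('X - l%:P%:P) = \sum_i (c i)%:P *: bez i y1 y2 ->
  c =1 fun=> 0.
Proof.
have aux a y z : a * ('X - l%:P%:P) = \sum_i (c i)%:P *: bez i y z ->
    y.[l%:P] * divdiff c z.[l%:P] = z.[l%:P] * divdiff c y.[l%:P].
  move=> /(congr1 (fun p => p.[l%:P])).
  rewrite hornerM hornerXsubC subrr mulr0 horner_sum.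
  under eq_bigr => i _ do rewrite hornerZ horner_bez.
  by rewrite sum_bezoutian => /esym/eqP; rewrite subr_eq0 => /eqP.
move=> /aux E1 /aux E2 /aux E3; have [top cop] := spread_horner l.
by apply: (bezoutian_indep _ _ _ top cop E1 E2 E3);
  apply: size_horner_bounded; [exact: y1P|exact: y2P|exact: y3P].
Qed.

End Bezoutian2.
End Bipoly.

(** * Absence of syzygies, and generation in bi-degree (3m - 1, 2n - 1) *)

Section Regularity.
Variables (C : numClosedFieldType) (m n : nat).
Notation bipoly := {poly {poly C}}.
Variables y1 y2 y3 : bipoly.
Hypotheses (y1P : bounded m.+1 n.+1 y1) (y2P : bounded m.+1 n.+1 y2)
  (y3P : bounded m.+1 n.+1 y3).

Section Combination.
Variables (a b c d : nat).
Hypotheses (ac : (m + a)%N = c) (bd : (n + b)%N = d).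
Let V : vectType C := ('M[C]_(a, b) * 'M[C]_(a, b) * 'M[C]_(a, b))%type.

Definition combine_poly (v : V) : bipoly :=
  of_mx v.1.1 * y1 + of_mx v.1.2 * y2 + of_mx v.2 * y3.
Definition combine (v : V) : 'M[C]_(c, d) := to_mx c d (combine_poly v).

Fact combine_is_linear : linear combine.
Proof.
move=> l u v; rewrite -to_mx_is_linear; congr to_mx.
rewrite /combine_poly /= !of_mx_is_linear -!mul_polyC; ring.
Qed.
HB.instance Definition _ := GRing.isLinear.Build C V 'M[C]_(c, d) _ combine combine_is_linear.

Lemma bounded_combine v : bounded c d (combine_poly v).
Proof.
rewrite -ac -bd; do 2?[apply: boundedD]; rewrite mulrC;
  by apply: boundedM => //; apply: bounded_of_mx.
Qed.

Lemma combine_eq0 v : (combine v == 0) = (combine_poly v == 0).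
Proof.
apply/eqP/eqP => [E|E]; last by rewrite /combine E; apply/matrixP => i j; rewrite !mxE !coef0.
by rewrite -(to_mxK (bounded_combine v)) -/(combine v) E of_mx0.
Qed.

End Combination.

Hypothesis spread_horner : forall l : C, spread n y1.[l%:P] y2.[l%:P] y3.[l%:P].
Hypothesis spread_infty : spread n y1`_m y2`_m y3`_m.

Notation V := ('M[C]_(2 * m, n) * 'M[C]_(2 * m, n) * 'M[C]_(2 * m, n))%type.
Let comb : V -> 'M[C]_(3 * m, 2 * n) := @combine (2 * m) n (3 * m) (2 * n).
HB.instance Definition _ := GRing.Linear.on comb.
Let K : {vspace V} := lker (linfun comb).

Lemma mem_syzygies v :
  v \in K <-> syzygy m n y1 y2 y3 (of_mx v.1.1) (of_mx v.1.2) (of_mx v.2).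
Proof.
rewrite memv_ker lfunE /= combine_eq0; try lia.
by split=> [/eqP E|[_ _ _ E]]; [split=> //; apply: bounded_of_mx|apply/eqP].
Qed.

(* Multiplication by s preserves the syzygies of this bi-degree modulo the
   Bezoutian ones; on an eigenvector of the induced endomorphism, s - l acts as
   a combination of Bezoutian syzygies, which are independent at s = l. *)
Lemma syzygies_trivial : K = 0%VS.
Proof.
apply/eqP; rewrite -dimv_eq0; apply/negPn/negP; rewrite -lt0n => K_gt0.
pose e := vbasis K.
have step (i : 'I_(\dim K)) : exists tc : ('I_(\dim K) -> C) * ('I_n -> C),
   [/\ of_mx (e`_i).1.1 * 'X = \sum_j (tc.1 j)%:P *: of_mx (e`_j).1.1
         + \sum_j (tc.2 j)%:P *: bez j y2 y3,
       of_mx (e`_i).1.2 * 'X = \sum_j (tc.1 j)%:P *: of_mx (e`_j).1.2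
         + \sum_j (tc.2 j)%:P *: bez j y3 y1 &
       of_mx (e`_i).2 * 'X = \sum_j (tc.1 j)%:P *: of_mx (e`_j).2
         + \sum_j (tc.2 j)%:P *: bez j y1 y2].
  have /mem_syzygies eK : e`_i \in K.
    by apply: vbasis_mem; apply: mem_nth; rewrite size_tuple.
  have [c [b1 b2 b3 E]] := syzygy_step y1P y2P y3P spread_infty eK.
  set a1 := _ - _ in b1 E; set a2 := _ - _ in b2 E; set a3 := _ - _ in b3 E.
  (* The corrected syzygy lies in [K] again; its coordinates in the basis [e] form a row of the
     matrix [T] below. *)
  pose w : V := (to_mx _ _ a1, to_mx _ _ a2, to_mx _ _ a3).
  have wK : w \in K by apply/mem_syzygies; rewrite /= !to_mxK.
  have wE := coord_vbasis wK.
  exists (fun j => coord e j w, c).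
  have comp (p : {linear V -> 'M[C]_(2 * m, n)}) :
      of_mx (p w) = \sum_j (coord e j w)%:P *: of_mx (p e`_j).
    rewrite {1}wE linear_sum -of_mx_sum; congr of_mx.
    by apply: eq_bigr => j _; rewrite linearZ.
  have E1 := comp (fst \o fst); have E2 := comp (snd \o fst); have E3 := comp snd.
  rewrite /= !to_mxK // in E1 E2 E3.
  by split; rewrite /= -?E1 -?E2 -?E3 subrK.
have [tc tcE] := fin_all_exists step.
pose T : 'M[C]_(\dim K) := \matrix_(i, j) (tc i).1 j.
have [l /eigenvalueP[z zT z0]] := eigenvalue_closed T K_gt0.
pose a : V := \sum_i z 0 i *: e`_i.
pose c (j : 'I_n) := \sum_i z 0 i * (tc i).2 j.
(* The projection [p] selects one of the three components. Since [z] is a left eigenvector of [T],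
   the part lying in [K] is [l] times [a], and only the Bezoutian part remains. *)
have key (p : {linear V -> 'M[C]_(2 * m, n)}) (B : 'I_n -> bipoly) :
    (forall i : 'I_(\dim K), of_mx (p e`_i) * 'X = \sum_j ((tc i).1 j)%:P *: of_mx (p e`_j)
         + \sum_j ((tc i).2 j)%:P *: B j) ->
    of_mx (p a) * ('X - l%:P%:P) = \sum_j (c j)%:P *: B j.
  move=> pE; have aE : of_mx (p a) = \sum_i (z 0 i)%:P *: of_mx (p e`_i).
    rewrite /a linear_sum -of_mx_sum; congr of_mx.
    by apply: eq_bigr => j _; rewrite linearZ.
  rewrite mulrBr {1}aE mulr_suml.
  under eq_bigr => i _ do rewrite -scalerAl pE scalerDr !scaler_sumr.
  rewrite big_split /= exchange_big /= [X in _ + X - _]exchange_big /=.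
  rewrite addrAC [X in X + _](_ : _ = 0) ?add0r.
    apply: eq_bigr => j _; rewrite /c raddf_sum /= scaler_suml.
    by apply: eq_bigr => i _; rewrite scalerA polyCM.
  rewrite mulrC mul_polyC aE scaler_sumr -sumrB big1 // => j _.
  rewrite scalerA -polyCM; have := congr1 (fun M : 'rV_(\dim K) => M 0 j) zT.
  rewrite !mxE => <-; rewrite raddf_sum /= scaler_suml -sumrB big1 // => i _.
  by rewrite scalerA mxE polyCM subrr.
have k1 := key (fst \o fst) _ (fun i => let: And3 E _ _ := tcE i in E).
have k2 := key (snd \o fst) _ (fun i => let: And3 _ E _ := tcE i in E).
have k3 := key snd _ (fun i => let: And3 _ _ E := tcE i in E).
have c0 := bez_indep y1P y2P y3P spread_horner k1 k2 k3.
have zero (q : bipoly) (B : 'I_n -> bipoly) :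
    q * ('X - l%:P%:P) = \sum_j (c j)%:P *: B j -> q = 0.
  rewrite big1 => [|j _]; last by rewrite c0 scale0r.
  by move=> /eqP; rewrite mulf_eq0 polyXsubC_eq0 orbF => /eqP.
have of_mx_inj : injective (@of_mx C (2 * m) n) := can_inj (@of_mxK _ _ _).
have a0 : a = 0.
  rewrite [a]surjective_pairing [a.1]surjective_pairing.
  congr (_, _, _); apply: of_mx_inj; rewrite of_mx0.
  - exact: zero k1.
  - exact: zero k2.
  - exact: zero k3.
case/negP: z0; apply/eqP/rowP => i; rewrite mxE.
have /freeP := basis_free (vbasisP K); apply; exact: a0.
Qed.

Lemma regularity q : bounded (3 * m) (2 * n) q ->
  exists a1 a2 a3, [/\ bounded (2 * m) n a1, bounded (2 * m) n a2,
    bounded (2 * m) n a3 & q = a1 * y1 + a2 * y2 + a3 * y3].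
Proof.
move=> qP; have : to_mx (3 * m) (2 * n) q \in limg (linfun comb).
  have -> : limg (linfun comb) = fullv; last exact: memvf.
  apply/eqP; rewrite eqEdim subvf /=.
  have := limg_ker_dim (linfun comb) fullv.
  rewrite capfv -/K syzygies_trivial dimv0 add0n => ->.
  have dV : dim V = (2 * m * n + 2 * m * n + 2 * m * n)%N by [].
  by rewrite !dimvf dV dim_matrix; lia.
case/memv_imgP => v _; rewrite lfunE /= => E.
exists (of_mx v.1.1), (of_mx v.1.2), (of_mx v.2); split; try exact: bounded_of_mx.
rewrite -(to_mxK qP) E /comb /combine to_mxK //; apply: bounded_combine; lia.
Qed.

End Regularity.

(** * Dehomogenization *)

Section Bihomogeneous.
Variable C : fieldType.
Implicit Types p q : {mpoly C[4]}.

Lemma bihomogeneous0 m n : bihomogeneous m n (0 : {mpoly C[4]}).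
Proof. by move=> mo; rewrite msupp0. Qed.

Lemma bihomogeneousD m n p q :
  bihomogeneous m n p -> bihomogeneous m n q -> bihomogeneous m n (p + q).
Proof. by move=> pP qP mo /msuppD_le; rewrite mem_cat => /orP[/pP|/qP]. Qed.

Lemma bihomogeneousZ m n c p : bihomogeneous m n p -> bihomogeneous m n (c *: p).
Proof. by move=> pP mo /msuppZ_le /pP. Qed.

Lemma bihomogeneous_sum m n (I : Type) (r : seq I) (P : pred I)
    (F : I -> {mpoly C[4]}) :
  (forall i, P i -> bihomogeneous m n (F i)) ->
  bihomogeneous m n (\sum_(i <- r | P i) F i).
Proof.
move=> FP; elim/big_rec: _ => [|i p Pi pP]; first exact: bihomogeneous0.
by apply: bihomogeneousD => //; apply: FP.
Qed.

Lemma bihomogeneousM a b c d p q :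
  bihomogeneous a b p -> bihomogeneous c d q -> bihomogeneous (a + c) (b + d) (p * q).
Proof.
move=> pP qP mo /msuppM_le /allpairsP[[m1 m2] /= [/pP[E1 E2] /qP[E3 E4] ->]].
by rewrite !mnmDE; lia.
Qed.

Lemma bihomogeneous1 : bihomogeneous 0 0 (1 : {mpoly C[4]}).
Proof. by move=> mo; rewrite msupp1 inE => /eqP ->; rewrite !mnm0E. Qed.

Lemma bihomogeneousX a b p i : bihomogeneous a b p -> bihomogeneous (i * a) (i * b) (p ^+ i).
Proof.
move=> pP; elim: i => [|i IH]; first by rewrite expr0; apply: bihomogeneous1.
by rewrite exprS !mulSn; apply: bihomogeneousM.
Qed.

Lemma bihomogeneous_monomial a b i j : (i <= a)%N -> (j <= b)%N ->
  bihomogeneous a b ('X_i_s ^+ i * 'X_i_u ^+ (a - i) * 'X_i_t ^+ j * 'X_i_v ^+ (b - j)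
    : {mpoly C[4]}).
Proof.
move=> ia jb mo; rewrite !mpolyXn -!mpolyXD msuppX inE => /eqP ->.
by rewrite !mnmDE !mulmnE !mnm1E /=; lia.
Qed.

Lemma bihomogeneous_prod (I : finType) (a b : I -> nat) (F : I -> {mpoly C[4]}) :
  (forall i, bihomogeneous (a i) (b i) (F i)) ->
  bihomogeneous (\sum_i a i) (\sum_i b i) (\prod_i F i).
Proof.
move=> FP; elim/big_ind3: _ => // [|a1 b1 F1 a2 b2 F2]; first exact: bihomogeneous1.
exact: bihomogeneousM.
Qed.

Lemma bihomogeneous_comp m n d (x : 4.-tuple {mpoly C[4]}) p :
  (forall a, bihomogeneous m n (tnth x a)) -> p \is d.-homog ->
  bihomogeneous (d * m) (d * n) (p \mPo x).
Proof.
move=> xP /dhomogP pP; rewrite comp_mpolyEX big_seq.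
apply: bihomogeneous_sum => mo mo_p; apply: bihomogeneousZ.
have <- : mdeg mo = d := pP mo mo_p.
rewrite mdegE !big_distrl comp_mpolyX /=; apply: bihomogeneous_prod => i.
exact: bihomogeneousX.
Qed.

Definition dehom_point (i : 'I_4) : {poly {poly C}} :=
  if i == i_s then 'X else if i == i_t then 'X%:P else 1.

Definition dehom : {mpoly C[4]} -> {poly {poly C}} :=
  mmap (@polyC {poly C} \o @polyC C) dehom_point.

HB.instance Definition _ := GRing.RMorphism.copy dehom
  (mmap (@polyC {poly C} \o @polyC C) dehom_point).

Lemma dehomE p : dehom p =
  \sum_(mo <- msupp p) (p@_mo)%:P%:P * ('X^(mo i_t))%:P * 'X^(mo i_s).
Proof.
apply: eq_bigr => mo _; rewrite /mmap1 !big_ord_recl big_ord0 /= -mulrA.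
congr (_ * _); rewrite /dehom_point !mulr1 /=.
rewrite !expr1n mul1r mulr1 mulrC -polyC_exp.
by congr ('X^(mo _)%:P * 'X^(mo _)); apply: val_inj.
Qed.

Lemma dehomZ c p : dehom (c *: p) = c%:P%:P * dehom p.
Proof. exact: mmapZ. Qed.

Lemma dehomXs : dehom 'X_i_s = 'X.
Proof. by rewrite /dehom mmapX mmap1U. Qed.
Lemma dehomXu : dehom 'X_i_u = 1.
Proof. by rewrite /dehom mmapX mmap1U. Qed.
Lemma dehomXt : dehom 'X_i_t = 'X%:P.
Proof. by rewrite /dehom mmapX mmap1U. Qed.
Lemma dehomXv : dehom 'X_i_v = 1.
Proof. by rewrite /dehom mmapX mmap1U. Qed.

Lemma coef_dehom p i j : (dehom p)`_i`_j =
  \sum_(mo <- msupp p | (mo i_s == i) && (mo i_t == j)) p@_mo.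
Proof.
rewrite dehomE !coef_sum [RHS]big_mkcond /=; apply: eq_bigr => mo _.
rewrite -polyCM coefCM coefXn eq_sym; case: eqP => /= _; last by rewrite mulr0 coef0.
by rewrite mulr1 coefCM coefXn eq_sym; case: eqP; rewrite ?mulr1 ?mulr0.
Qed.

Lemma bounded_dehom m n p : bihomogeneous m n p -> bounded m.+1 n.+1 (dehom p).
Proof.
move=> pP; split=> [|i]; apply/leq_sizeP => j ltj.
  apply/polyP => l; rewrite coef0 coef_dehom big_seq_cond big_pred0 // => mo.
  by apply/negP => /andP[/pP[? _] /andP[/eqP ? _]]; lia.
rewrite coef_dehom big_seq_cond big_pred0 // => mo.
by apply/negP => /andP[/pP[_ ?] /andP[_ /eqP ?]]; lia.
Qed.

Lemma mnm4P (m1 m2 : 'X_{1..4}) : m1 i_s = m2 i_s -> m1 i_u = m2 i_u ->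
  m1 i_t = m2 i_t -> m1 i_v = m2 i_v -> m1 = m2.
Proof.
move=> E1 E2 E3 E4; apply/mnmP => -[[|[|[|[|i]]]] lti] //.
- by rewrite (_ : Ordinal lti = i_s) //; apply: val_inj.
- by rewrite (_ : Ordinal lti = i_u) //; apply: val_inj.
- by rewrite (_ : Ordinal lti = i_t) //; apply: val_inj.
- by rewrite (_ : Ordinal lti = i_v) //; apply: val_inj.
Qed.

(** The bi-degree recovers the exponents of u and v from those of s and t, so no two monomials merge
    at u = v = 1. *)
Lemma dehom_eq0 m n p : bihomogeneous m n p -> dehom p = 0 -> p = 0.
Proof.
move=> pP p0; apply/mpolyP => mo; rewrite mcoeff0.
have [mo_p|/memN_msupp_eq0 //] := boolP (mo \in msupp p).
have := coef_dehom p (mo i_s) (mo i_t); rewrite p0 !coef0 big_mkcond.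
rewrite (bigD1_seq mo mo_p (msupp_uniq p)) /= !eqxx /= big_seq_cond.
rewrite big1 ?addr0 => [->//|mo' /andP[mo'_p /eqP ne]].
case: andP => // -[/eqP Es /eqP Et]; case: ne.
have [? ?] := pP _ mo_p; have [? ?] := pP _ mo'_p.
by apply: mnm4P => //; lia.
Qed.

Lemma meval4 p (v : 'I_4 -> C) : p.@[v] = \sum_(mo <- msupp p) p@_mo *
  (v i_s ^+ mo i_s * v i_u ^+ mo i_u * v i_t ^+ mo i_t * v i_v ^+ mo i_v).
Proof.
rewrite mevalE; apply: eq_bigr => mo _; congr (_ * _).
rewrite !big_ord_recl big_ord0 /= mulr1 !mulrA.
by congr (v _ ^+ mo _ * v _ ^+ mo _ * v _ ^+ mo _ * v _ ^+ mo _); apply: val_inj.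
Qed.

Definition point4 (a b c d : C) (i : 'I_4) : C := nth 0 [:: a; b; c; d] i.

Lemma horner_dehom p l z : (dehom p).[l%:P].[z] = p.@[point4 l 1 z 1].
Proof.
rewrite dehomE meval4 !horner_sum; apply: eq_bigr => mo _.
rewrite !(hornerM, hornerC, hornerXn, horner_exp).
by rewrite /point4 /= !expr1n; ring.
Qed.

(** At u = 0 only the monomials of full degree [m] in s survive, so s = infinity is read off the
    coefficient of s^m. The next two lemmas treat t = infinity in the same way, for finite and for
    infinite s. *)
Lemma horner_dehom_infty m n p z : bihomogeneous m n p ->
  ((dehom p)`_m).[z] = p.@[point4 1 0 z 1].
Proof.
move=> pP; rewrite dehomE meval4 coef_sum horner_sum big_seq [RHS]big_seq.
apply: eq_bigr => mo /pP[E _].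
rewrite -polyCM coefCM coefXn /point4 /= !expr1n expr0n.
rewrite (_ : (m == mo i_s) = (mo i_u == 0)); last by lia.
by rewrite !hornerM hornerC hornerXn -polyC_natr hornerC; ring.
Qed.

Lemma coef_horner_dehom m n p l : bihomogeneous m n p ->
  ((dehom p).[l%:P])`_n = p.@[point4 l 1 1 0].
Proof.
move=> pP; rewrite dehomE meval4 horner_sum coef_sum big_seq [RHS]big_seq.
apply: eq_bigr => mo /pP[_ E].
rewrite !hornerM !hornerC hornerXn -polyC_exp coefMC coefCM coefXn.
rewrite /point4 /= !expr1n expr0n.
by rewrite (_ : (n == mo i_t) = (mo i_v == 0)); [ring|lia].
Qed.

Lemma coef_dehom_infty m n p : bihomogeneous m n p ->
  (dehom p)`_m`_n = p.@[point4 1 0 1 0].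
Proof.
move=> pP; rewrite coef_dehom meval4 big_mkcond big_seq [RHS]big_seq.
apply: eq_bigr => mo /pP[E1 E2]; rewrite /point4 /= !expr1n !expr0n.
rewrite (_ : (mo i_s == m) = (mo i_u == 0)); last by lia.
rewrite (_ : (mo i_t == n) = (mo i_v == 0)); last by lia.
by case: (mo i_u == 0)%N; case: (mo i_v == 0)%N; rewrite /= ?(mulr1, mulr0, mul1r).
Qed.

End Bihomogeneous.

(** On a fibre of s, finite or infinite, a simultaneous drop of the three degrees is a common zero
    at t = infinity, and a common root is one at finite t. *)
Lemma spread_dehom (C : closedFieldType) m n (y1 y2 y3 : {mpoly C[4]}) :
  bihomogeneous m n y1 -> bihomogeneous m n y2 -> bihomogeneous m n y3 ->
  (forall p, biprojective p -> ~ [/\ y1.@[p] = 0, y2.@[p] = 0 & y3.@[p] = 0]) ->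
  (forall l : C, spread n (dehom y1).[l%:P] (dehom y2).[l%:P] (dehom y3).[l%:P]) /\
  spread n (dehom y1)`_m (dehom y2)`_m (dehom y3)`_m.
Proof.
move=> P1 P2 P3 H.
have B1 := bounded_dehom P1; have B2 := bounded_dehom P2; have B3 := bounded_dehom P3.
have top (f : {poly C}) : (size f <= n.+1)%N -> size f != n.+1 -> f`_n = 0.
  by move=> sf nf; apply: nth_default; move: sf; rewrite leq_eqVlt (negbTE nf).
have o1 : (1 : C) != 0 by apply: oner_neq0.
split=> [l|]; split; try (apply: coprime3_closed => z [/rootP E1 /rootP E2 /rootP E3]).
- apply/negPn/negP; rewrite !negb_or => /and3P[n1 n2 n3].
  have := H (point4 l 1 1 0); rewrite /biprojective /point4 /= o1 orbT => /(_ isT) [].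
  rewrite -(coef_horner_dehom _ P1) -(coef_horner_dehom _ P2) -(coef_horner_dehom _ P3).
  by split; [exact: (top _ (size_horner_bounded l B1) n1)|
    exact: (top _ (size_horner_bounded l B2) n2)|
    exact: (top _ (size_horner_bounded l B3) n3)].
- have := H (point4 l 1 z 1); rewrite /biprojective /point4 /= o1 !orbT => /(_ isT) [].
  by rewrite -!horner_dehom; split; [exact: E1|exact: E2|exact: E3].
- apply/negPn/negP; rewrite !negb_or => /and3P[n1 n2 n3].
  have := H (point4 1 0 1 0); rewrite /biprojective /point4 /= o1 => /(_ isT) [].
  rewrite -(coef_dehom_infty P1) -(coef_dehom_infty P2) -(coef_dehom_infty P3).
  by split; [exact: (top _ (proj2 B1 m) n1)|exact: (top _ (proj2 B2 m) n2)|
    exact: (top _ (proj2 B3 m) n3)].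
- have := H (point4 1 0 z 1); rewrite /biprojective /point4 /= o1 orbT => /(_ isT) [].
  rewrite -(horner_dehom_infty _ P1) -(horner_dehom_infty _ P2) -(horner_dehom_infty _ P3).
  by split; [exact: E1|exact: E2|exact: E3].
Qed.

(** * Moving quadrics *)

Section Splitting.
Variable k : fieldType.
Notation bipoly := {poly {poly k}}.

Lemma bounded_mulXn a b c (q : bipoly) :
  bounded a b q -> bounded (c + a) b ('X^c * q).
Proof.
move=> qP; rewrite -[b]add0n; apply: boundedM => //.
by split=> [|i]; rewrite ?size_polyXn // coefXn; case: eqP; rewrite ?size_poly1 ?size_poly0.
Qed.

Lemma bounded_mulYn a b c (q : bipoly) :
  bounded a b q -> bounded a (c + b) (('X^c)%:P * q).
Proof.
move=> qP; rewrite -[a]add0n; apply: boundedM => //.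
split=> [|i]; first exact: size_polyC_leq1.
by rewrite coefC; case: eqP; rewrite ?size_polyXn ?size_poly0.
Qed.

Lemma boundedW a b c d (q : bipoly) : (a <= c)%N -> (b <= d)%N ->
  bounded a b q -> bounded c d q.
Proof. by move=> ac bd [sq tq]; split=> [|i]; apply: leq_trans; eauto. Qed.

Lemma bounded_monomial a b i j : (i < a)%N -> (j < b)%N ->
  bounded a b ('X^i * ('X^j)%:P : bipoly).
Proof.
move=> ia jb; apply: (@boundedW (i + 1) (j + 1)); [by rewrite addn1|by rewrite addn1|].
apply: bounded_mulXn; rewrite -[(_)%:P]mulr1; apply: bounded_mulYn.
split=> [|l]; first by rewrite size_poly1.
by rewrite coef1; case: eqP; rewrite ?size_poly1 ?size_poly0.
Qed.

(** The top third is written as s^a times s^a times a remainder, so both pieces have s-degree below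
    2a. This carries a surjectivity from degree 2a - 1 up to 3a - 1. *)
Lemma bounded_splitX a b (q : bipoly) : bounded (a + a + a) b q ->
  exists q0 q1, [/\ bounded (a + a) b q0, bounded (a + a) b q1 & q = q0 + 'X^a * q1].
Proof.
move=> [sq tq]; exists (take_poly (a + a) q), ('X^a * drop_poly (a + a) q); split.
- split=> [|i]; first exact: size_take_poly.
  by rewrite coef_take_poly; case: ifP; rewrite ?size_poly0.
- apply: bounded_mulXn; split=> [|i]; last by rewrite coef_drop_poly.
  by apply: leq_trans (size_drop_poly_le _ sq) _; rewrite addKn.
- by rewrite mulrA -exprD mulrC poly_take_drop.
Qed.

Lemma bounded_splitY a b (q : bipoly) : bounded a (b + b + b) q ->
  exists q0 q1, [/\ bounded a (b + b) q0, bounded a (b + b) q1 &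
    q = q0 + ('X^b)%:P * q1].
Proof.
move=> [sq tq]; exists (map_poly (take_poly (b + b)) q).
exists (('X^b)%:P * map_poly (drop_poly (b + b)) q); split.
- split=> [|i]; first by apply: leq_trans sq; apply: size_poly.
  by rewrite coef_map_id0 ?take_poly0r // size_take_poly.
- apply: bounded_mulYn; split=> [|i]; first by apply: leq_trans sq; apply: size_poly.
  rewrite coef_map_id0 ?drop_poly0r //.
  by apply: leq_trans (size_drop_poly_le _ (tq i)) _; rewrite addKn.
- apply/polyP => i; rewrite mulrA -polyCM -exprD coefD coefCM.
  by rewrite !coef_map_id0 ?drop_poly0r ?take_poly0r // mulrC poly_take_drop.
Qed.

End Splitting.

(** [regularity] reaches t-degrees below 2n; splitting [q] as q0 + t^n q1, with both pieces in that
    range, reaches 3n. *)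
Lemma regularity_square (C : numClosedFieldType) m n (y1 y2 y3 q : {poly {poly C}}) :
  bounded m.+1 n.+1 y1 -> bounded m.+1 n.+1 y2 -> bounded m.+1 n.+1 y3 ->
  (forall l : C, spread n y1.[l%:P] y2.[l%:P] y3.[l%:P]) ->
  spread n y1`_m y2`_m y3`_m -> bounded (3 * m) (3 * n) q ->
  exists a1 a2 a3, [/\ bounded (2 * m) (2 * n) a1, bounded (2 * m) (2 * n) a2,
    bounded (2 * m) (2 * n) a3 & q = y1 * a1 + y2 * a2 + y3 * a3].
Proof.
move=> P1 P2 P3 sh si qP.
have E2 : (2 * n = n + n)%N by lia.
have := qP; rewrite [(3 * n)%N](_ : _ = n + n + n)%N; last by lia.
move=> /bounded_splitY[q0 [q1 []]]; rewrite -E2 => q0P q1P ->.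
have [a1 [a2 [a3 [A1 A2 A3 ->]]]] := regularity P1 P2 P3 sh si q0P.
have [b1 [b2 [b3 [B1 B2 B3 ->]]]] := regularity P1 P2 P3 sh si q1P.
pose w a b : {poly {poly C}} := a + ('X^n)%:P * b.
have wP a b : bounded (2 * m) n a -> bounded (2 * m) n b ->
    bounded (2 * m) (2 * n) (w a b).
  move=> aP bP; rewrite E2; apply: boundedD; last exact: bounded_mulYn.
  by apply: boundedW aP => //; rewrite leq_addr.
exists (w a1 b1), (w a2 b2), (w a3 b3); split; try exact: wP.
by rewrite /w; ring.
Qed.

Lemma sum3 (V : nmodType) (F : 'I_3 -> V) : \sum_i F i = F 0 + F 1 + F 2%:R.
Proof.
rewrite !big_ord_recl big_ord0 addr0 addrA.
by congr (F _ + F _ + F _); apply: val_inj.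
Qed.

(** * Substitution of the parametrization into moving surfaces *)

Section MovingSurfaces.
Variables (C : numClosedFieldType) (m n : nat) (x : 4.-tuple {mpoly C[4]}).
Hypothesis x_bihomog : forall a : 'I_4, bihomogeneous m.+1 n.+1 (tnth x a).
Notation bipoly := {poly {poly C}}.

(** The left-hand side of [follows] at u = v = 1. The parametrization has bi-degree (m + 1, n + 1)
    here, so that moving surfaces have bi-degree (m, n). *)
Definition substitute d (A : moving_surface C d m n) : bipoly :=
  \sum_(i < m.+1) \sum_(j < n.+1)
    dehom (mpoly_of_dhomog (A (i, j)) \mPo x) * ('X^i * ('X^j)%:P).

Lemma bounded_substitute d (A : moving_surface C d m n) :
  bounded (d.+1 * m.+1) (d.+1 * n.+1) (substitute A).
Proof.
apply: bounded_sum => i; apply: bounded_sum => j.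
rewrite !mulSn ![(_.+1 + _ * _.+1)%N]addnC.
apply: boundedM; first exact: (bounded_dehom (bihomogeneous_comp x_bihomog (dhomog_is_dhomog _))).
exact: bounded_monomial.
Qed.

Lemma followsE d (A : moving_surface C d m n) : follows x A <-> substitute A = 0.
Proof.
pose G := \sum_(i < m.+1) \sum_(j < n.+1) (mpoly_of_dhomog (A (i, j)) \mPo x) *
  ('X_i_s ^+ i * 'X_i_u ^+ (m - i) * 'X_i_t ^+ j * 'X_i_v ^+ (n - j)).
have dG : dehom G = substitute A.
  rewrite /G rmorph_sum /=; apply: eq_bigr => i _.
  rewrite rmorph_sum /=; apply: eq_bigr => j _.
  rewrite !rmorphM /= !rmorphXn /= dehomXs dehomXu dehomXt dehomXv.
  by rewrite !expr1n !mulr1 mulrA.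
split=> [|E]; first by rewrite /follows -/G -dG => ->; rewrite rmorph0.
have : dehom G = 0 by rewrite dG.
apply: dehom_eq0; apply: bihomogeneous_sum => i _; apply: bihomogeneous_sum => j _.
apply: bihomogeneousM; first exact: (bihomogeneous_comp x_bihomog (dhomog_is_dhomog _)).
by apply: bihomogeneous_monomial; rewrite -ltnS.
Qed.

Definition substitute_mx d (A : moving_surface C d m n) :
  'M[C]_(d.+1 * m.+1, d.+1 * n.+1) := to_mx _ _ (substitute A).

Fact substitute_mx_is_linear d : linear (@substitute_mx d).
Proof.
move=> l A B; rewrite -to_mx_is_linear; congr to_mx.
rewrite /substitute scaler_sumr -big_split /=; apply: eq_bigr => i _.
rewrite scaler_sumr -big_split /=; apply: eq_bigr => j _.
rewrite !ffunE /= comp_mpolyD comp_mpolyZ rmorphD /= dehomZ mulrDl -mulrA.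
by rewrite mul_polyC.
Qed.
HB.instance Definition _ d := GRing.isLinear.Build C (moving_surface C d m n)
  'M[C]_(d.+1 * m.+1, d.+1 * n.+1) _ (@substitute_mx d) (@substitute_mx_is_linear d).

Lemma substitute_mx_eq0 d (A : moving_surface C d m n) :
  substitute_mx A = 0 <-> substitute A = 0.
Proof.
split=> E; last by rewrite /substitute_mx E; apply/matrixP => i j; rewrite !mxE !coef0.
by rewrite -(to_mxK (bounded_substitute A)) -/(substitute_mx A) E of_mx0.
Qed.

Definition following_surfaces d : {vspace (moving_surface C d m n)} :=
  lker (linfun (@substitute_mx d)).

Lemma mem_following d (A : moving_surface C d m n) :
  (A \in following_surfaces d) <-> follows x A.
Proof.
rewrite memv_ker lfunE /= followsE -substitute_mx_eq0.
by split=> /eqP.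
Qed.

Lemma dim_moving_surface d :
  dim (moving_surface C d m n) = (m.+1 * n.+1 * 'C(d + 3, d))%N.
Proof.
transitivity (#|{: 'I_m.+1 * 'I_n.+1}| * 'C(d + 3, d))%N; first by [].
by rewrite card_prod !card_ord.
Qed.

Definition mul_form d (l : dhomog 4 C 1) (A : moving_surface C d m n) :
    moving_surface C (1 + d) m n :=
  [ffun ij => DHomog (dhomogM (dhomog_is_dhomog l) (dhomog_is_dhomog (A ij)))].

Lemma substitute_mul_form d (l : dhomog 4 C 1) (A : moving_surface C d m n) :
  substitute (mul_form l A) = dehom (mpoly_of_dhomog l \mPo x) * substitute A.
Proof.
rewrite /substitute [RHS]mulr_sumr; apply: eq_bigr => i _.
rewrite [RHS]mulr_sumr; apply: eq_bigr => j _.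
by rewrite ffunE /= !rmorphM /= -mulrA.
Qed.

Fact homog_coordinate a : ('X_a : {mpoly C[4]}) \is 1.-homog.
Proof. by rewrite dhomogX /= mdeg1. Qed.

Definition coordinate_form (a : 'I_4) : dhomog 4 C 1 := DHomog (homog_coordinate a).

Lemma linear_formE (G : {mpoly C[4]}) : G \is 1.-homog ->
  G = \sum_a G@_(U_(a)%MM) *: 'X_a.
Proof.
move=> /dhomogP GP; apply/mpolyP => mo; rewrite raddf_sum /=.
have [/mdeg1P[a /eqP ->]|ne] := boolP (mdeg mo == 1%N).
  rewrite (bigD1 a) //= mcoeffZ mcoeffX eqxx mulr1 big1 ?addr0 // => b ba.
  rewrite mcoeffZ mcoeffX (_ : (_ == _) = false) ?mulr0 //.
  apply/negP => /eqP/mnmP/(_ b); rewrite !mnm1E eqxx.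
  by rewrite eq_sym (negbTE ba).
rewrite big1 => [|b _].
  by apply: memN_msupp_eq0; apply: contraNN ne => /GP /= ->.
rewrite mcoeffZ mcoeffX (_ : (_ == _) = false) ?mulr0 //.
by apply/negP => /eqP E; rewrite -E mdeg1 eqxx in ne.
Qed.

Lemma substitute_linear (A : moving_surface C 1 m n) :
  exists v : 'I_4 -> bipoly, (forall a, bounded m.+1 n.+1 (v a)) /\
    substitute A = \sum_a dehom (tnth x a) * v a.
Proof.
exists (fun a => \sum_(i < m.+1) \sum_(j < n.+1)
  ((mpoly_of_dhomog (A (i, j)))@_(U_(a)%MM))%:P%:P * ('X^i * ('X^j)%:P)).
split=> [a|].
  apply: bounded_sum => i; apply: bounded_sum => j.
  by rewrite mul_polyC; apply/boundedZ/bounded_monomial.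
under [RHS]eq_bigr => a _ do rewrite mulr_sumr.
rewrite exchange_big /=; apply: eq_bigr => i _.
under [RHS]eq_bigr => a _ do rewrite mulr_sumr.
rewrite exchange_big /=; apply: eq_bigr => j _.
rewrite {1}(linear_formE (dhomog_is_dhomog (A (i, j)))).
rewrite (raddf_sum (comp_mpoly x)) rmorph_sum mulr_suml /=; apply: eq_bigr => a _.
by rewrite comp_mpolyZ comp_mpolyXU -tnth_nth dehomZ; ring.
Qed.

Hypothesis no_planes : forall A : moving_surface C 1 m n, follows x A -> A = 0.

(** Without moving planes, substitution is injective on a space of dimension 4(m + 1)(n + 1), which
    is also the dimension of the target. *)
Lemma moving_planes_onto w : bounded (2 * m.+1) (2 * n.+1) w ->
  exists A : moving_surface C 1 m n, w = substitute A.
Proof.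
move=> wP; have : to_mx (2 * m.+1) (2 * n.+1) w \in limg (linfun (@substitute_mx 1)).
  have -> : limg (linfun (@substitute_mx 1)) = fullv; last exact: memvf.
  apply/eqP; rewrite eqEdim subvf /=.
  have := limg_ker_dim (linfun (@substitute_mx 1)) fullv.
  rewrite capfv (_ : lker _ = 0%VS) ?dimv0 ?add0n => [->|].
    by rewrite !dimvf dim_moving_surface dim_matrix (_ : 'C(1 + 3, 1) = 4) //; lia.
  apply/eqP; rewrite -subv0; apply/subvP => A /mem_following /no_planes ->.
  exact: mem0v.
case/memv_imgP => A _; rewrite lfunE /= => E; exists A.
by rewrite -(to_mxK wP) E to_mxK //; apply: bounded_substitute.
Qed.

(** Starting from the range covered by moving planes, the bi-degree is raised first in t, then in s;
    each splitting leaves two pieces in a range already covered, and its monomial is absorbed into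
    the coefficients. *)
Lemma ideal_full q : bounded (3 * m.+1) (3 * n.+1) q ->
  exists w : 'I_4 -> bipoly, (forall a, bounded (2 * m.+1) (2 * n.+1) (w a)) /\
    q = \sum_a dehom (tnth x a) * w a.
Proof.
have E2 d : (2 * d = d + d)%N by lia.
have E3 d : (3 * d = d + d + d)%N by lia.
have combine_split (M N : nat) (p0 p1 r q0 : bipoly) :
    (exists v : 'I_4 -> bipoly, (forall a, bounded M N (v a)) /\
       p0 = \sum_a dehom (tnth x a) * v a) ->
    (exists v : 'I_4 -> bipoly, (forall a, bounded M N (r * v a)) /\
       p1 = \sum_a dehom (tnth x a) * v a) -> q0 = p0 + r * p1 ->
    exists v : 'I_4 -> bipoly, (forall a, bounded M N (v a)) /\
       q0 = \sum_a dehom (tnth x a) * v a.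
  move=> [v0 [v0P ->]] [v1 [v1P ->]] ->; exists (fun a => v0 a + r * v1 a).
  split=> [a|]; first exact: boundedD.
  by rewrite mulr_sumr -big_split /=; apply: eq_bigr => a _; ring.
have small w : bounded (m.+1 + m.+1) (n.+1 + n.+1) w ->
    exists v : 'I_4 -> bipoly, (forall a, bounded m.+1 n.+1 (v a)) /\
    w = \sum_a dehom (tnth x a) * v a.
  rewrite -!E2 => /moving_planes_onto[A ->]; exact: substitute_linear.
have middle w : bounded (m.+1 + m.+1) (n.+1 + n.+1 + n.+1) w ->
    exists v : 'I_4 -> bipoly, (forall a, bounded m.+1 (n.+1 + n.+1) (v a)) /\
    w = \sum_a dehom (tnth x a) * v a.
  move=> /bounded_splitY[q0 [q1 [/small[v0 [v0P q0E]] /small[v1 [v1P q1E]] wE]]].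
  apply: combine_split wE; [exists v0; split=> // a|exists v1; split=> // a].
    by apply: boundedW (v0P a) => //; rewrite leq_addr.
  exact: bounded_mulYn.
rewrite !E2 !E3 => /bounded_splitX[q0 [q1 [/middle[v0 [v0P q0E]] /middle[v1 [v1P q1E]] qE]]].
apply: combine_split qE; [exists v0; split=> // a|exists v1; split=> // a].
  by apply: boundedW (v0P a) => //; rewrite leq_addr.
exact: bounded_mulXn.
Qed.

Fact substitute_is_additive d : {morph (@substitute d) : A B / A + B}.
Proof.
move=> A B; rewrite /substitute -big_split /=; apply: eq_bigr => i _.
rewrite -big_split /=; apply: eq_bigr => j _.
by rewrite ffunE /= comp_mpolyD rmorphD /= mulrDl.
Qed.

Lemma substitute0 d : substitute (0 : moving_surface C d m n) = 0.
Proof.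
rewrite /substitute big1 // => i _; rewrite big1 // => j _.
by rewrite ffunE /= comp_mpoly0 rmorph0 mul0r.
Qed.

(** Each [w a] comes from a moving plane, and that plane times the linear form [l a] is a moving
    quadric. *)
Lemma sum_forms_onto (I : finType) (l : I -> dhomog 4 C 1) (w : I -> bipoly) :
  (forall a, bounded (2 * m.+1) (2 * n.+1) (w a)) ->
  exists2 A : I -> moving_surface C 1 m n, forall a, w a = substitute (A a) &
    substitute (\sum_a mul_form (l a) (A a)) =
    \sum_a dehom (mpoly_of_dhomog (l a) \mPo x) * w a.
Proof.
move=> wP; have [A AE] := fin_all_exists (fun a => moving_planes_onto (wP a)).
exists A => //.
rewrite (big_morph (@substitute (1 + 1)) (@substitute_is_additive _) (substitute0 _)).
by apply: eq_bigr => a _; rewrite substitute_mul_form AE.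
Qed.

Lemma limg_full d (U : {vspace moving_surface C d m n}) :
  (forall q, bounded (d.+1 * m.+1) (d.+1 * n.+1) q ->
     exists2 A, A \in U & substitute A = q) ->
  (linfun (@substitute_mx d) @: U)%VS = fullv.
Proof.
move=> onto; apply/eqP; rewrite eqEsubv subvf; apply/subvP => M _.
have [A AU AE] := onto _ (bounded_of_mx M).
by apply/memv_imgP; exists A => //; rewrite lfunE /= /substitute_mx AE of_mxK.
Qed.

Lemma dim_following_quadrics : \dim (following_surfaces 2) = (m.+1 * n.+1)%N.
Proof.
have := limg_ker_dim (linfun (@substitute_mx 2)) fullv.
rewrite limg_full => [|q /ideal_full[w [wP ->]]].
  rewrite capfv !dimvf dim_moving_surface dim_matrix -/(following_surfaces 2).
  rewrite (_ : 'C(2 + 3, 2) = 10) // -[(_ * _)%R]/(_ * _)%N.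
  by move: (\dim _) => d; lia.
have [A _ AE] := sum_forms_onto coordinate_form wP.
exists (\sum_a mul_form (coordinate_form a) (A a)); first exact: memvf.
rewrite AE; apply: eq_bigr => a _; congr (_ * _).
by rewrite comp_mpolyXU -tnth_nth.
Qed.

(** * Moving quadrics at a point off the image *)

Section OffImage.
Variables (y : 'I_4 -> C) (a0 : 'I_4).
Hypothesis ya0 : y a0 != 0.
Hypothesis x_no_base : no_base_points x.
Hypothesis y_off : forall p, biprojective p ->
  ~ exists c, forall a, y a = c * param_eval x p a.

Definition meval_surface d (A : moving_surface C d m n) : 'M[C]_(m.+1, n.+1) :=
  \matrix_(i, j) (mpoly_of_dhomog (A (i, j))).@[y].

Fact meval_surface_is_linear d : linear (@meval_surface d).
Proof.
move=> l A B; apply/matrixP => i j.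
by rewrite !mxE !ffunE /= mevalD mevalZ.
Qed.
HB.instance Definition _ d := GRing.isLinear.Build C (moving_surface C d m n)
  'M[C]_(m.+1, n.+1) _ (@meval_surface d) (@meval_surface_is_linear d).

(** These forms cut out the point [y]; [lift a0] runs over the three coordinates other than [a0], at
    which [y] is nonzero. *)
Definition line_form_poly (i : 'I_3) : {mpoly C[4]} :=
  y a0 *: 'X_(lift a0 i) - y (lift a0 i) *: 'X_a0.

Fact homog_line_form i : line_form_poly i \is 1.-homog.
Proof. by apply: rpredB; apply: rpredZ; apply: homog_coordinate. Qed.

Definition line_form i : dhomog 4 C 1 := DHomog (homog_line_form i).

Lemma meval_line_form i : (line_form_poly i).@[y] = 0.
Proof. by rewrite mevalB !mevalZ !mevalXU mulrC subrr. Qed.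

Lemma bihomog_line_form i : bihomogeneous m.+1 n.+1 (line_form_poly i \mPo x).
Proof.
rewrite -[m.+1]mul1n -[n.+1]mul1n.
exact: (bihomogeneous_comp x_bihomog (homog_line_form i)).
Qed.

(** At a common zero the image point is proportional to [y]. Its coordinate [a0] is nonzero, since
    otherwise all four would vanish and [p] would be a base point. *)
Lemma line_forms_no_zero p : biprojective p ->
  ~ [/\ (line_form_poly 0 \mPo x).@[p] = 0, (line_form_poly 1 \mPo x).@[p] = 0 &
        (line_form_poly 2%:R \mPo x).@[p] = 0].
Proof.
move=> pP [E0 E1 E2].
have E (i : 'I_3) : y a0 * param_eval x p (lift a0 i) =
    y (lift a0 i) * param_eval x p a0.
  have : (line_form_poly i \mPo x).@[p] = 0.
    case: i => -[|[|[|i]]] lti; last by [].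
    - by rewrite (_ : Ordinal lti = 0); [exact: E0|apply: val_inj].
    - by rewrite (_ : Ordinal lti = 1); [exact: E1|apply: val_inj].
    - by rewrite (_ : Ordinal lti = 2%:R); [exact: E2|apply: val_inj].
  rewrite comp_mpoly_meval mevalB !mevalZ !mevalXU => /eqP.
  by rewrite subr_eq0 => /eqP.
have xa0 : param_eval x p a0 != 0.
  apply/eqP => xa0; have [b] := x_no_base pP.
  case: (unliftP a0 b) => [i|] -> /eqP[] //.
  by apply: (mulfI ya0); rewrite E xa0 !mulr0.
apply: (y_off pP); exists (y a0 / param_eval x p a0) => b.
case: (unliftP a0 b) => [i|] ->; last by rewrite divfK.
by rewrite mulrAC E mulfK.
Qed.

Lemma quadrics_off_image (A : moving_surface C 2 m n) :
  follows x A -> meval_surface A = 0 -> A = 0.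
Proof.
move=> /mem_following Afol Ay.
pose K := lker (linfun (@meval_surface 2)).
have KE B : (B \in K) = (meval_surface B == 0) by rewrite memv_ker lfunE.
have full : (linfun (@substitute_mx 2) @: K)%VS = fullv.
  apply: limg_full => q qP.
  have [sh si] := spread_dehom (bihomog_line_form (i := 0))
    (bihomog_line_form (i := 1)) (bihomog_line_form (i := 2%:R)) line_forms_no_zero.
  have dP i := bounded_dehom (bihomog_line_form (i := i)).
  have [a1 [a2 [a3 [A1 A2 A3 ->]]]] := regularity_square (dP _) (dP _) (dP _) sh si qP.
  pose w (i : 'I_3) := [:: a1; a2; a3]`_i.
  have wP i : bounded (2 * m.+1) (2 * n.+1) (w i) by case: i => -[|[|[|i]]] lti.
  have [B _ BE] := sum_forms_onto line_form wP.
  (* The lift is a combination of the forms [line_form], so it vanishes at [y] and lies in [K]. *)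
  exists (\sum_a mul_form (line_form a) (B a)); last first.
    exact: etrans BE (sum3 _).
  rewrite KE linear_sum big1 // => i _; apply/matrixP => j l.
  by rewrite !mxE ffunE /= mevalM meval_line_form mul0r.
(* The square of the coordinate [a0] is nonzero at [y], so every matrix of values is attained. This
   gives the exact dimension of [K]. *)
have ev_full : limg (linfun (@meval_surface 2)) = fullv.
  apply/eqP; rewrite eqEsubv subvf; apply/subvP => M _.
  have homog_sq : ('X_a0 * 'X_a0 : {mpoly C[4]}) \is 2.-homog.
    exact: (dhomogM (homog_coordinate a0) (homog_coordinate a0)).
  pose B : moving_surface C 2 m n :=
    [ffun ij => DHomog (rpredZ (M ij.1 ij.2 / (y a0 * y a0)) homog_sq)].
  apply/memv_imgP; exists B; rewrite ?memvf // lfunE.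
  apply/matrixP => i j; rewrite mxE ffunE /= mevalZ mevalM mevalXU divfK //.
  by rewrite mulf_neq0.
have dimK : \dim K = (9 * (m.+1 * n.+1))%N.
  have := limg_ker_dim (linfun (@meval_surface 2)) fullv.
  rewrite capfv -/K ev_full !dimvf dim_moving_surface dim_matrix.
  rewrite (_ : 'C(2 + 3, 2) = 10) // -[(_ * _)%R]/(_ * _)%N.
  by move: (\dim _) => d; lia.
have := limg_ker_dim (linfun (@substitute_mx 2)) K.
rewrite full dimK dimvf dim_matrix -[(_ * _)%R]/(_ * _)%N => dim0.
have : \dim (K :&: following_surfaces 2) == 0.
  by move: dim0; rewrite -/(following_surfaces 2); move: (\dim _) => d; lia.
rewrite dimv_eq0 -subv0 => /subvP/(_ A); rewrite memv_cap Afol KE Ay eqxx.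
by rewrite memv0 => /(_ isT)/eqP.
Qed.

End OffImage.

End MovingSurfaces.

(** * The determinant of the matrix of moving quadrics *)

Definition row_index m n (r : 'I_(m.+1 * n.+1)) : 'I_m.+1 * 'I_n.+1 :=
  (inord (r %/ n.+1), inord (r %% n.+1)).

Lemma row_index_bij m n : bijective (@row_index m n).
Proof.
apply: inj_card_bij; last by rewrite card_prod !card_ord.
move=> r1 r2 [/(congr1 val) /= E1 /(congr1 val) /= E2]; apply: val_inj => /=.
have lt_div (r : 'I_(m.+1 * n.+1)) : (r %/ n.+1 < m.+1)%N by rewrite ltn_divLR.
move: E1 E2; rewrite !inordK ?ltn_mod ?lt_div // => E1 E2.
by rewrite (divn_eq r1 n.+1) (divn_eq r2 n.+1) E1 E2.
Qed.

Lemma dhomog_det (C : fieldType) k d N (A : 'M[{mpoly C[k]}]_N) :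
  (forall i j, A i j \is d.-homog) -> \det A \is (d * N).-homog.
Proof.
move=> AP; apply: rpred_sum => s _.
have sP : \prod_i A i (s i) \is (d * N).-homog.
  have -> : (d * N = \sum_(i < N) d)%N by rewrite sum_nat_const card_ord mulnC.
  elim/big_ind2: _ => [|p e q f pP qP|i _]; [exact: dhomog1|exact: dhomogM|exact: AP].
by rewrite mulr_sign; case: ifP => // _; rewrite dhomogN.
Qed.

Section Determinant.
Variables (C : numClosedFieldType) (m n : nat) (x : 4.-tuple {mpoly C[4]}).
Hypothesis x_bihomog : forall a : 'I_4, bihomogeneous m.+1 n.+1 (tnth x a).
Hypothesis x_no_base : no_base_points x.
Hypothesis no_planes : forall A : moving_surface C 1 m n, follows x A -> A = 0.

Lemma following_basis_exists :
  exists b : (m.+1 * n.+1).-tuple (moving_surface C 2 m n),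
    following_quadrics_basis (m := m.+1) (n := n.+1) x b.
Proof.
have szb : size (vbasis (following_surfaces m n x 2)) == (m.+1 * n.+1)%N.
  by rewrite size_tuple dim_following_quadrics.
have bP := vbasisP (following_surfaces m n x 2).
exists (Tuple szb); split; first exact: (basis_free bP).
by move=> A; rewrite -(mem_following x_bihomog) /= (span_basis bP).
Qed.

Variable b : (m.+1 * n.+1).-tuple (moving_surface C 2 m n).
Hypothesis b_basis : following_quadrics_basis (m := m.+1) (n := n.+1) x b.
Let M := moving_quadrics_matrix (m := m.+1) (n := n.+1) b.

Lemma matrixE r c : M r c = mpoly_of_dhomog (tnth b c (row_index r)).
Proof. by rewrite mxE. Qed.

Lemma det_homog : \det M \is (2 * (m.+1 * n.+1)).-homog.
Proof. by apply: dhomog_det => r c; rewrite matrixE; apply: dhomog_is_dhomog. Qed.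

Lemma meval_det (y : 'I_4 -> C) : (\det M).@[y] = \det (map_mx (meval y) M).
Proof. by rewrite det_map_mx. Qed.

Lemma det_on_image p : biprojective p -> (\det M).@[param_eval x p] = 0.
Proof.
move=> /andP[su tv]; rewrite meval_det; apply/eqP/det0P.
pose mono (ij : 'I_m.+1 * 'I_n.+1) :=
  p i_s ^+ ij.1 * p i_u ^+ (m - ij.1) * p i_t ^+ ij.2 * p i_v ^+ (n - ij.2).
exists (\row_r mono (row_index r)).
  (* The extreme exponents give a pure power of s or of u, whichever coordinate is nonzero. *)
  have [i inz] : exists i : 'I_m.+1, p i_s ^+ i * p i_u ^+ (m - i) != 0.
    case/orP: su => nz; [exists ord_max|exists ord0].
      by rewrite subnn expr0 mulr1 expf_neq0.
    by rewrite expr0 mul1r subn0 expf_neq0.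
  have [j jnz] : exists j : 'I_n.+1, p i_t ^+ j * p i_v ^+ (n - j) != 0.
    case/orP: tv => nz; [exists ord_max|exists ord0].
      by rewrite subnn expr0 mulr1 expf_neq0.
    by rewrite expr0 mul1r subn0 expf_neq0.
  have [g gK1 gK2] := row_index_bij m n.
  apply/eqP => /rowP/(_ (g (i, j))); rewrite !mxE gK2 /mono /= => /eqP.
  by rewrite -mulrA mulf_eq0 (negbTE inz) (negbTE jnz).
apply/rowP => c; rewrite !mxE.
have : follows x (tnth b c).
  by apply/(proj2 b_basis)/memv_span/mem_tnth.
(* Evaluated at [p] and indexed by rows, the relation satisfied by this moving quadric is entry [c]
   of the product of the row vector with the matrix. *)
move=> /(congr1 (meval p)); rewrite pair_bigA /= raddf_sum raddf0 /=.
rewrite (reindex _ (onW_bij _ (row_index_bij m n))) /= => E.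
rewrite -[RHS]E; apply: eq_bigr => r _.
rewrite !mxE !mevalM comp_mpoly_meval !rmorphXn /= !mevalXU mulrC.
by congr (_ * _).
Qed.

(** A right kernel vector at [y], obtained through the transpose, combines the basis into a
    following quadric that vanishes at [y]. Off the image that quadric is zero, against freeness of
    the basis. *)
Lemma det_off_image (y : 'I_4 -> C) : projective y -> (\det M).@[y] = 0 ->
  exists2 p, biprojective p & exists c, forall a, y a = c * param_eval x p a.
Proof.
move=> [a0 ya0]; rewrite meval_det -det_tr => /eqP/det0P[v v0 vM].
apply: boolp.contrapT => H.
have off p : biprojective p -> ~ exists c, forall a, y a = c * param_eval x p a.
  by move=> pP cP; apply: H; exists p.
pose A : moving_surface C 2 m n := \sum_c v 0 c *: tnth b c.
have A0 : A = 0.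
  apply: (quadrics_off_image x_bihomog no_planes ya0 x_no_base off).
    apply/(proj2 b_basis)/memv_suml => c _; apply/memvZ/memv_span/mem_tnth.
  apply/matrixP => i j; rewrite !mxE /A sum_ffunE linear_sum raddf_sum /=.
  have [g _ gK] := row_index_bij m n.
  have := congr1 (fun w : 'rV_(m.+1 * n.+1) => w 0 (g (i, j))) vM.
  rewrite !mxE => E; rewrite -[RHS]E; apply: eq_bigr => c _.
  by rewrite ffunE mevalZ !mxE -[(inord _, inord _)]/(row_index _) gK.
case/negP: v0; apply/eqP/rowP => c; rewrite mxE.
have /freeP := proj1 b_basis; apply.
by rewrite -[RHS]A0; apply: eq_bigr => i _; rewrite -tnth_nth.
Qed.

(** [det_off_image] sends zeros of the determinant to zeros of [F]. The converse is the minimality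
    of [F], applied to the determinant as a nonzero form of positive degree vanishing on the
    image. *)
Lemma det_power F : implicit_equation x F ->
  exists (lambda : C) (k : nat),
    [/\ lambda != 0, (1 <= k)%N & \det M = lambda *: F ^+ k].
Proof.
case=> -[F0 [d d_gt0 F_homog]] F_irr F_van F_min.
(* The Nullstellensatz is affine while the other facts concern projective points; this settles the
   origin. *)
have homog0 (G : {mpoly C[4]}) e (y : 'I_4 -> C) : (0 < e)%N -> G \is e.-homog ->
    ~ projective y -> G.@[y] = 0.
  move=> e0 /dhomogP GP yP; rewrite mevalE big_seq big1 // => mo /GP mo_e.
  have y0 a : y a = 0.
    by apply/eqP/negPn/negP => ya; apply: yP; exists a.
  have [a moa] : exists a, mo a != 0%N.
    apply/existsP; apply: contraTT e0; rewrite negb_exists -eqn0Ngt -mo_e /=.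
    move=> /forallP moP; rewrite mdegE big1 // => a _.
    by apply/eqP; have := moP a; rewrite negbK.
  by rewrite (bigD1 a) //= y0 expr0n (negbTE moa) mul0r mulr0.
have det_F y : (\det M).@[y] = 0 -> F.@[y] = 0.
  move=> dy; have [yP|yP] := boolp.EM (projective y); last exact: homog0 F_homog yP.
  have [p pP [c yE]] := det_off_image yP dy.
  rewrite (meval_eq _ yE).
  have [xp] := x_no_base pP.
  move=> _; have := F_van p pP (x_no_base pP).
  (* By homogeneity, scaling the point by [c] multiplies the value of [F] by c^d. *)
  rewrite !mevalE => Fp; rewrite (eq_big_seq (fun mo =>
     c ^+ d * (F@_mo * \prod_i param_eval x p i ^+ mo i))) => [|mo mo_F].
    by rewrite -mulr_sumr Fp mulr0.
  rewrite mulrCA; congr (_ * _).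
  have <- : mdeg mo = d := dhomogP _ _ _ F_homog mo mo_F.
  rewrite mdegE -prodrXr -big_split /=; apply: eq_bigr => i _.
  by rewrite exprMn.
(* Where [F] is nonzero, the determinant is nonzero too by [det_F]. *)
have det0 : \det M != 0.
  have [y Fy] := mpoly_nonroot F0.
  by apply: contraNneq Fy => E; rewrite det_F // E meval0.
apply: same_zeros_power => // y; split=> [Fy|/det_F//].
have [yP|yP] := boolp.EM (projective y); last exact: homog0 det_homog yP.
apply: (F_min (\det M)) Fy => //.
  by split=> //; exists (2 * (m.+1 * n.+1))%N => //; apply: det_homog.
by move=> p pP _; apply: det_on_image.
Qed.

End Determinant.

Theorem corollary4p6 (R : realType) (m n : nat) (x : 4.-tuple {mpoly R[i][4]})
  (m_gt0 : (1 <= m)%N) (n_gt0 : (1 <= n)%N)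
  (x_bihomog : forall a : 'I_4, bihomogeneous m n (tnth x a))
  (x_surface : defines_surface x)
  (x_no_base : no_base_points x)
  (no_moving_planes : forall A : moving_plane R[i] m.-1 n.-1,
      follows x A -> A = 0) :
  (exists b : (m * n).-tuple (moving_quadric R[i] m.-1 n.-1),
      following_quadrics_basis x b) /\
  (forall (F : {mpoly R[i][4]})
      (b : (m * n).-tuple (moving_quadric R[i] m.-1 n.-1)),
    implicit_equation x F -> following_quadrics_basis x b ->
    exists (lambda : R[i]) (k : nat),
      [/\ lambda != 0, (1 <= k)%N &
          \det (moving_quadrics_matrix b) = lambda *: F ^+ k]).
Proof.
case: m m_gt0 n n_gt0 x_bihomog no_moving_planes => [//|m] _ [//|n] _ xP planes.
split; first exact: following_basis_exists xP planes.
by move=> F b FP bP; apply: det_power xP x_no_base planes _ bP _ FP.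
Qed.
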